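(* Let $R=K[x_1,x_2,x_3]$ be the polynomial ring over a field $K$ of characteristic zero, and consider the graded reverse lexicographic order on $R$. Let $I$ be a graded Artinian ideal of $R$, and suppose that $R/I$ has the SLP. Then the generic initial ideal $\operatorname{gin}(I)$ is the unique almost revlex ideal $J\subset R$ such that $R/J$ has the same Hilbert function as $R/I$. In particular, $\operatorname{gin}(I)$ is uniquely determined by the Hilbert function of $R/I$.
   Context: $R=K[x_1,\ldots,x_n]$ has the standard grading (here $n=3$). A graded (homogeneous) ideal $I$ of $R$ is Artinian if $\dim_K R/I<\infty$. The Hilbert function of $A=R/I$ is $t\mapsto\dim_K A_t$. SLP: a graded Artinian $K$-algebra $A=\bigoplus_i A_i$ has the strong Lefschetz property (SLP) if there is $\ell\in A_1$ such that for all $i\ge 0$ and $s>0$ the multiplication map $\times\ell^s:A_i\to A_{i+s}$ has full rank (is injective or surjective). Graded reverse lexicographic order $>_{\text{revlex}}$ (with $x_1>x_2>\cdots>x_n$): $x^a>_{\text{revlex}}x^b$ if $\deg x^a>\deg x^b$, or the degrees are equal and the last nonzero entry of $a-b$ is negative. Generic initial ideal: for $g=(g_{ij})\in GL(n;K)$ let $g$ act on $R$ as the $K$-algebra automorphism with $gx_j=\sum_i g_{ij}x_i$. There is a nonempty Zariski open subset $U\subset GL(n;K)$ such that the initial ideals of $g(I)$ with respect to the graded reverse lexicographic order coincide for all $g\in U$; this common initial ideal is $\operatorname{gin}(I)$. Almost revlex ideal: a monomial ideal $J$ such that for each monomial $u$ in the minimal generating set of $J$, every monomial $v$ with $\deg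 v=\deg u$ and $v>_{\text{revlex}}u$ belongs to $J$. *)

(* Defs.v *)
From mathcomp Require Import all_boot all_order all_algebra.
From mathcomp Require Import boolp classical_sets.
From mathcomp Require Import mpoly.

Set Implicit Arguments.
Unset Strict Implicit.
Unset Printing Implicit Defensive.

Import GRing.Theory.

Local Open Scope classical_set_scope.
Local Open Scope ring_scope.

(* The variables x_1 > x_2 > ... > x_n are 'X_0, ..., 'X_(n-1). *)

Section Ideals.
Variables (K : fieldType) (n : nat).
Local Notation R := {mpoly K[n]}.
Implicit Types (I J : set R) (f p q : R) (m u v : 'X_{1..n}).

(* The unit ideal is allowed. *)
Definition is_ideal I : Prop :=
  [/\ I 0, (forall p q, I p -> I q -> I (p + q))
    & (forall p q, I q -> I (p * q))].

Definition ideal_gen (S : set R) : set R := smallest is_ideal S.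

Definition homog_part (d : nat) : set R := [set p | p \is d.-homog].

Definition graded_ideal I : Prop :=
  is_ideal I /\ forall d p, I p -> I (pihomog mdeg d p).

(* dim_K V / (V `&` W) = d, for linear subspaces V and W of L: there is a
   family of d vectors of V whose classes form a basis of the quotient. *)
Definition dim_quot (L : lmodType K) (V W : set L) (d : nat) : Prop :=
  exists b : 'I_d -> L,
    [/\ forall i, V (b i),
        forall c : 'I_d -> K, W (\sum_i c i *: b i) -> forall i, c i = 0
      & forall x, V x -> exists c : 'I_d -> K, W (x - \sum_i c i *: b i)].

Definition artinian I : Prop := exists d, dim_quot setT I d.

(* dim_K (R / I)_t. The default 0 is never used when I is an ideal, because
   the homogeneous polynomials of degree t form a finite-dimensional space,
   so that exactly one d satisfies dim_quot. *)
Definition hilbert_function I (t : nat) : nat :=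
  xget 0%N [set d | dim_quot (homog_part t) I d].

(* The elements of (R / I)_i are the classes of the forms of degree i, and
   multiplication by the class of l ^+ s is written on representatives. *)
Definition mul_injective I f (i : nat) : Prop :=
  forall p q, homog_part i p -> homog_part i q -> I (f * p - f * q) -> I (p - q).

Definition mul_surjective I f (i j : nat) : Prop :=
  forall q, homog_part j q -> exists2 p, homog_part i p & I (q - f * p).

Definition SLP I : Prop :=
  exists2 l, homog_part 1 l &
    forall i s, (0 < s)%N ->
      mul_injective I (l ^+ s) i \/ mul_surjective I (l ^+ s) i (i + s).

(* revlex_gt u v : u is strictly greater than v. The order on 'X_{1..n}
   provided by mpoly (hence mlead) is the graded lexicographic one, and
   cannot be used. *)
Definition revlex_gt u v : bool :=
  (mdeg v < mdeg u)%N
  || (mdeg u == mdeg v)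
     && [exists i : 'I_n, (u i < v i)%N
           && [forall j : 'I_n, (i < j)%N ==> (u j == v j)]].

Definition initial_monomial f m : Prop :=
  m \in msupp f /\ forall v, v \in msupp f -> v != m -> revlex_gt m v.

Definition monomials (G : set 'X_{1..n}) : set R := [set 'X_[m] | m in G].

Definition initial_ideal I : set R :=
  ideal_gen (monomials [set m | exists2 f, I f & initial_monomial f m]).

Definition minimal_monomial_generators J (G : set 'X_{1..n}) : Prop :=
  J = ideal_gen (monomials G) /\
  forall G', G' `<=` G -> J = ideal_gen (monomials G') -> G' = G.

Definition almost_revlex J : Prop :=
  exists2 G, minimal_monomial_generators J G &
    forall u v, G u -> mdeg v = mdeg u -> revlex_gt v u -> J 'X_[v].

Definition coord_change (g : 'M[K]_n) f : R :=
  f \mPo [tuple \sum_(i < n) g i j *: 'X_i | j < n].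

(* Zariski open subsets of GL(n; K): complements of common zero loci of
   polynomials in the n * n matrix entries. *)
Definition zariski_open (U : set 'M[K]_n) : Prop :=
  exists P : set {mpoly K[n * n]},
    U = [set g | g \in unitmx /\ exists2 p, P p & p.@[mxvec g ord0] != 0].

Definition is_gin I J : Prop :=
  exists U : set 'M[K]_n,
    [/\ zariski_open U, U !=set0
      & forall g, U g -> initial_ideal (coord_change g @` I) = J].

(* Takes the value set0, which is not an ideal, if no J satisfies is_gin I J. *)
Definition gin I : set R := xget set0 (is_gin I).

End Ideals.

(* Main.v *)
(* Write L for the set of initial monomials of g(I), g generic. In each degree L is
   read off from the ranks of the projections of g(I) to sets of monomials; these
   ranks are maximal for generic g, and I contains all forms of large degree, so L
   does not depend on g and spans gin(I). Maximality of the ranks has two further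
   consequences. Deforming g by x_j |-> x_j + t x_i with i < j, a tangent space
   argument in characteristic zero shows that L is stable under u |-> u x_i / x_j.
   Comparing g with a change of coordinates that takes a Lefschetz element to x_3
   shows that x_3 is a Lefschetz element for gin(I). For three variables these two
   properties imply that gin(I) is almost revlex.
   Finally, in an almost revlex ideal the monomials of degree d are the multiples of
   those of degree d - 1 together with an initial segment, so the ideal is
   determined by its Hilbert function, degree by degree. *)

From HB Require Import structures.
Require Import Defs.
From mathcomp Require Import all_boot all_order all_algebra perm.
From mathcomp Require Import boolp classical_sets.
From mathcomp Require Import mpoly ring.

Set Implicit Arguments.
Unset Strict Implicit.
Unset Printing Implicit Defensive.

Import GRing.Theory.

Local Open Scope classical_set_scope.
Local Open Scope ring_scope.

(** Every use of genericity is drawn from one rank inequality, [maximal_ranks], which compares a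
    fixed g with an arbitrary matrix h. It can therefore be tested against special h: the products
    of transvections with g, and a change of coordinates adapted to the Lefschetz element, for which
    no maximality is known. Only degrees below a bound D are constrained; this leaves finitely many
    polynomial conditions, and a field of characteristic zero, being infinite, has points that
    satisfy them. [gin] is a choice among the ideals satisfying [is_gin]. Nothing is known about the
    open set behind it except that it is nonempty, but this suffices for it to meet the locus of the
    rank conditions. Three variables matter at the very end: once the degree and the exponent of x_3
    are fixed, the monomials form a chain under the move from x_2 to x_1. *)

(** * The reverse lexicographic order on monomials *)

Section Revlex.
Variable n : nat.
Implicit Types u v w : 'X_{1..n}.

Lemma revlexP u v : mdeg u = mdeg v ->
  reflect (exists2 i : 'I_n, (u i < v i)%N & forall j : 'I_n, (i < j)%N -> u j = v j)
          (revlex_gt u v).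
Proof.
move=> duv; rewrite /revlex_gt duv ltnn eqxx /=.
apply: (iffP existsP) => [[i /andP[ui /forallP uv]]|[i ui uv]]; exists i => //.
  by move=> j ij; apply/eqP; apply: (implyP (uv j)).
by rewrite ui; apply/forallP => j; apply/implyP => /uv ->.
Qed.

Lemma revlex_irr u : revlex_gt u u = false.
Proof. by apply/(revlexP erefl) => -[i]; rewrite ltnn. Qed.

Lemma revlex_mdeg u v : revlex_gt u v -> (mdeg v <= mdeg u)%N.
Proof. by case/orP => [/ltnW //|/andP[/eqP ->]]. Qed.

Lemma revlex_trans v u w : revlex_gt u v -> revlex_gt v w -> revlex_gt u w.
Proof.
case/orP => [uv /revlex_mdeg vw|/andP[/eqP duv uv]].
  by rewrite /revlex_gt (leq_ltn_trans vw uv).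
case/orP => [vw|/andP[/eqP dvw vw]]; first by rewrite /revlex_gt duv vw.
have {}uv : revlex_gt u v by rewrite /revlex_gt duv eqxx uv orbT.
have {}vw : revlex_gt v w by rewrite /revlex_gt dvw eqxx vw orbT.
have [i ui iuv] := revlexP duv uv; have [k vk kvw] := revlexP dvw vw.
have duw := etrans duv dvw; apply/(revlexP duw).
case: (ltngtP i k) => ik.
- exists k => [|j kj]; first by rewrite iuv.
  by rewrite iuv ?kvw // (ltn_trans ik).
- exists i => [|j ij]; first by rewrite -kvw.
  by rewrite iuv ?kvw // (ltn_trans ik).
- have eik : i = k by apply: val_inj.
  subst k; exists i => [|j ij]; first exact: ltn_trans ui vk.
  by rewrite iuv ?kvw.
Qed.

Lemma revlex_total u v : u != v -> revlex_gt u v || revlex_gt v u.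
Proof.
move=> neq_uv; rewrite {1 2}/revlex_gt.
case: (ltngtP (mdeg u) (mdeg v)) => [||duv]; rewrite ?orbT //=.
have [i0 Pi0] : exists i, u i != v i.
  apply/existsP; apply: contraNT neq_uv; rewrite negb_exists => /forallP uv.
  by apply/eqP/mnmP => i; apply/eqP; have:= uv i; rewrite negbK.
case: (@arg_maxnP _ i0 (fun i => u i != v i) (fun i : 'I_n => i : nat) Pi0) => i Pi maxi.
have eqj (j : 'I_n) : (i < j)%N -> u j = v j.
  by move=> ij; apply: contraTeq ij => /maxi; rewrite -leqNgt.
case: (ltngtP (u i) (v i)) Pi => // uvi _; apply/orP; [left|right].
  by apply/existsP; exists i; rewrite uvi; apply/forallP => j; apply/implyP => /eqj ->.
by apply/existsP; exists i; rewrite uvi; apply/forallP => j; apply/implyP => /eqj ->.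
Qed.

Lemma revlex_add2r w u v : revlex_gt (u + w)%MM (v + w)%MM = revlex_gt u v.
Proof.
rewrite /revlex_gt !mdegD ltn_add2r eqn_add2r; congr (_ || _ && _).
apply: eq_existsb => i; rewrite !mnmDE ltn_add2r; congr (_ && _).
by apply: eq_forallb => j; rewrite !mnmDE eqn_add2r.
Qed.

(** The exponent of the last variable is compared first. Hence, within a degree, the monomials not
    divisible by a given power of the last variable lie above all the others; this ties revlex to
    multiplication by such powers. *)
Lemma revlex_last_leq (i : 'I_n) u v : mdeg u = mdeg v ->
  (forall j : 'I_n, (j <= i)%N) -> revlex_gt u v -> (u i <= v i)%N.
Proof.
move=> duv maxi /(revlexP duv)[k uk kuv].
have := maxi k; rewrite leq_eqVlt => /predU1P[/val_inj <-|/kuv ->] //.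
exact: ltnW.
Qed.

Lemma revlex_last_lt (i : 'I_n) u v : mdeg u = mdeg v ->
  (forall j : 'I_n, (j <= i)%N) -> (u i < v i)%N -> revlex_gt u v.
Proof.
move=> duv maxi uvi; apply/revlexP => //; exists i => // j.
by rewrite ltnNge maxi.
Qed.

Lemma revlex_max (s : seq 'X_{1..n}) : s != [::] ->
  exists2 m, m \in s & forall v, v \in s -> v != m -> revlex_gt m v.
Proof.
elim: s => // a s IHs _; have [->|/IHs[m ms maxm]] := eqVneq s [::].
  by exists a; rewrite ?mem_head // => v; rewrite inE => ->.
have [->|am] := eqVneq a m.
  exists m; rewrite ?mem_head // => v; rewrite inE => /predU1P[->|/maxm] //.
  by rewrite eqxx.
case/orP: (revlex_total am) => [gam|gma]; last first.
  exists m; first by rewrite inE ms orbT.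
  by move=> v; rewrite inE => /predU1P[->|/maxm].
exists a; rewrite ?mem_head // => v; rewrite inE => /predU1P[->|vs va].
  by rewrite eqxx.
have [->//|vm] := eqVneq v m; exact: revlex_trans gam (maxm v vs vm).
Qed.

End Revlex.

(** * Monomial ideals and initial monomials *)

Section MonomialIdeals.
Variables (K : fieldType) (n : nat).
Local Notation R := {mpoly K[n]}.
Implicit Types (I J : set R) (f p q : R) (m u v : 'X_{1..n}) (S : set 'X_{1..n}).

Lemma initial_monomial_exists f : f != 0 -> exists m, initial_monomial f m.
Proof.
rewrite -msupp_eq0 => /revlex_max[m mf maxm]; by exists m.
Qed.

Definition upset S : set 'X_{1..n} := [set m | exists2 s, S s & (s <= m)%MM].

Lemma upset_is_ideal S :
  is_ideal ([set p | forall m, m \in msupp p -> upset S m] : set R).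
Proof.
split=> [m|q r qS rS m|q r rS m]; first by rewrite msupp0.
  by move/msuppD_le; rewrite mem_cat => /orP[/qS|/rS].
move/msuppM_le/allpairsP => -[[u v] /= [uq vr ->]].
have [s Ss sv] := rS _ vr; exists s => //.
exact: lepm_trans sv (lem_addl _ _).
Qed.

Lemma ideal_genE S : ideal_gen (monomials (K := K) S) =
  [set p | forall m, m \in msupp p -> upset S m].
Proof.
apply/seteqP; split => p /=.
  move/(_ [set p | forall m, m \in msupp p -> upset S m]); apply; split; first exact: upset_is_ideal.
  by move=> _ [m Sm <-] u /mem_msuppXP <-; exists m => //; exact: lepm_refl.
move=> pS T [[T0 TD TM] ST]; rewrite [p]mpolyE.
rewrite big_seq; elim/big_ind: _ => // m /pS[s Ss sm].
rewrite -(submK sm) mpolyXD scalerAl; apply: TM.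
by apply: ST; exists s.
Qed.

Lemma ideal_gen_monomial S m : ideal_gen (monomials (K := K) S) 'X_[m] <-> upset S m.
Proof.
rewrite ideal_genE; split=> [|Sm u /mem_msuppXP <-] //.
by apply; rewrite msuppX mem_head.
Qed.

(** Named so that [initial_ideal I] unfolds to [ideal_gen (monomials (Lead I))]. *)
Definition Lead I : set 'X_{1..n} := [set m | exists2 f, I f & initial_monomial f m].

Lemma initial_monomialM f m u : initial_monomial f m ->
  initial_monomial ('X_[u] * f) (m + u)%MM.
Proof.
case=> mf maxm; rewrite mulrC; split=> [|v].
  by rewrite mcoeff_msupp addmC mcoeffMX -mcoeff_msupp.
rewrite (perm_mem (msuppMX f u)) => /mapP[w wf ->].
by rewrite addmC eqm_add2r revlex_add2r; exact: maxm.
Qed.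

Lemma Lead_upset I : is_ideal I -> upset (Lead I) = Lead I.
Proof.
case=> _ _ IM; apply/seteqP; split=> m; last by exists m => //; exact: lepm_refl.
case=> s [f If fs] sm; exists ('X_[m - s] * f); first exact: IM.
by have:= initial_monomialM (m - s) fs; rewrite addmC submK.
Qed.

Lemma ideal_scale I c p : is_ideal I -> I p -> I (c *: p).
Proof. by case=> _ _ IM Ip; rewrite -mul_mpolyC; apply: IM. Qed.

Lemma ideal_sum I (T : Type) (r : seq T) (P : pred T) (F : T -> R) : is_ideal I ->
  (forall i, P i -> I (F i)) -> I (\sum_(i <- r | P i) F i).
Proof. by case=> I0 ID _ IF; elim/big_ind: _. Qed.

Lemma mcoeff_pihomog d p m : (pihomog mdeg d p)@_m = if mdeg m == d then p@_m else 0.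
Proof.
rewrite pihomogE raddf_sum /=; case: ifP => dm; last first.
  rewrite big1 // => u /eqP du; rewrite mcoeffZ mcoeffX.
  by case: eqP => [um|]; rewrite ?mulr0 // -um du eqxx in dm *.
rewrite [in RHS](mpolyE p) raddf_sum /= big_mkcond /=.
apply: eq_bigr => u _; rewrite mcoeffZ mcoeffX.
by case: (eqVneq u m) => [->|_]; rewrite ?dm // !mulr0; case: ifP.
Qed.

(** Passing to the component of degree [mdeg m] keeps m and only shrinks the support, so m remains
    initial. *)
Lemma Lead_homog I m : graded_ideal I -> Lead I m ->
  exists2 f, I f & f \is (mdeg m).-homog /\ initial_monomial f m.
Proof.
case=> _ gI [f If [mf maxm]]; exists (pihomog mdeg (mdeg m) f); first exact: gI.
split; first exact: pihomogP.
split; first by rewrite mcoeff_msupp mcoeff_pihomog eqxx -mcoeff_msupp.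
move=> v; rewrite mcoeff_msupp mcoeff_pihomog; case: ifP => _; last by rewrite eqxx.
by rewrite -mcoeff_msupp; exact: maxm.
Qed.

Lemma ideal_gen_graded S : graded_ideal (ideal_gen (monomials (K := K) S)).
Proof.
rewrite ideal_genE; split=> [|d p pS m]; first exact: upset_is_ideal.
rewrite mcoeff_msupp mcoeff_pihomog.
by case: ifP => _; [rewrite -mcoeff_msupp; exact: pS|rewrite eqxx].
Qed.

Lemma Lead_ideal_gen S : Lead (ideal_gen (monomials (K := K) S)) = upset S.
Proof.
apply/seteqP; split=> m.
  by case=> f; rewrite ideal_genE => fS [mf _]; exact: fS.
move=> Sm; exists 'X_[m]; first exact/ideal_gen_monomial.
split; first by rewrite msuppX mem_head.
by move=> v /mem_msuppXP <-; rewrite eqxx.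
Qed.

Lemma Lead_initial_ideal I : is_ideal I -> Lead (initial_ideal I) = Lead I.
Proof. by move=> idI; rewrite Lead_ideal_gen Lead_upset. Qed.

End MonomialIdeals.

(** * Dimension of a quotient space *)

Section DimQuot.
Variables (K : fieldType) (L : lmodType K) (V W : set L).

Definition subspace (U : set L) : Prop :=
  [/\ U 0, (forall x y, U x -> U y -> U (x + y)) & forall c x, U x -> U (c *: x)].

Lemma subspace_sum U (T : Type) (r : seq T) (F : T -> L) : subspace U ->
  (forall i, U (F i)) -> U (\sum_(i <- r) F i).
Proof. by case=> U0 UD _ UF; elim/big_ind: _. Qed.

Hypothesis subW : subspace W.

(** Steinitz bound: if d < d', the matrix expressing b' through b modulo W has a nonzero left kernel
    vector, which is a relation between the b' modulo W. *)
Lemma independent_leq_span d d' (b : 'I_d -> L) (b' : 'I_d' -> L) :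
  (forall i, exists c : 'I_d -> K, W (b' i - \sum_j c j *: b j)) ->
  (forall c : 'I_d' -> K, W (\sum_i c i *: b' i) -> forall i, c i = 0) ->
  (d' <= d)%N.
Proof.
move=> span indep; have [c Wc] := choice span.
pose C := \matrix_(i, j) c i j; rewrite leqNgt; apply/negP => ltdd'.
have /rowV0Pn[u /sub_kermxP uC /eqP[]] : kermx C != 0.
  by rewrite -mxrank_eq0 mxrank_ker subn_eq0 -ltnNge (leq_ltn_trans (rank_leq_col C)).
apply/rowP => i; rewrite mxE; apply: (indep (u 0)) => {i}.
have -> : \sum_i u 0 i *: b' i = \sum_i u 0 i *: (b' i - \sum_j c i j *: b j).
  under [RHS]eq_bigr do rewrite scalerBr; rewrite sumrB.
  rewrite (_ : \sum_i u 0 i *: \sum_j c i j *: b j = 0) ?subr0 //.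
  under eq_bigr do rewrite scaler_sumr; rewrite exchange_big big1 //= => j _.
  under eq_bigr do rewrite scalerA; rewrite -scaler_suml.
  have /rowP/(_ j) := uC; rewrite !mxE.
  by under eq_bigr do rewrite mxE; move=> ->; rewrite scale0r.
by apply: subspace_sum => // i; case: subW => _ _; exact.
Qed.

Lemma dim_quot_uniq d d' : dim_quot V W d -> dim_quot V W d' -> d = d'.
Proof.
move=> [b [Vb ib sb]] [b' [Vb' ib' sb']]; apply/eqP; rewrite eqn_leq.
by rewrite (independent_leq_span (b := b') (b' := b)) ?(independent_leq_span (b := b) (b' := b')) // => i; auto.
Qed.

End DimQuot.

(** * Standard monomials and the Hilbert function *)

Section Hilbert.
Variables (K : fieldType) (n : nat).
Local Notation R := {mpoly K[n]}.
Implicit Types (I J : set R) (f p q : R) (m u v : 'X_{1..n}) (S : set 'X_{1..n}).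

Lemma ideal_subspace I : is_ideal I -> subspace I.
Proof.
move=> idI; case: (idI) => I0 ID _; split=> // c x; exact: ideal_scale.
Qed.

Lemma hilbert_functionE I t d : is_ideal I ->
  dim_quot (homog_part (n := n) t) I d -> hilbert_function I t = d.
Proof.
move=> idI dimI; rewrite /hilbert_function; case: xgetP => [e _ /= dimI'|/(_ d)//].
exact: (dim_quot_uniq (ideal_subspace idI) dimI' dimI).
Qed.

Definition mons (d : nat) : seq 'X_{1..n} := [seq s2m t | t : d.-tuple 'I_n <- enum (basis n d)].

Lemma mem_mons d m : (m \in mons d) = (mdeg m == d).
Proof. by rewrite [RHS]basis_cover. Qed.

Lemma mons_uniq d : uniq (mons d).
Proof. exact: uniq_basis. Qed.

Lemma homog_partP d p : homog_part d p <-> forall m, m \in msupp p -> mdeg m = d.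
Proof. by split=> [/dhomogP|?]; last exact/dhomogP. Qed.

(* Division by elements of I, by induction on the rank of the initial monomial. *)
Lemma standard_span I t p : graded_ideal I -> p \is t.-homog ->
  exists2 q, I (p - q) & forall m, m \in msupp q -> mdeg m = t /\ ~ Lead I m.
Proof.
move=> gI; have [idI _] := gI; have [I0 ID IM] := idI.
pose rk m := count (revlex_gt m) (mons t).
have rk_lt m v : m \in mons t -> v \in mons t -> revlex_gt m v -> (rk v < rk m)%N.
  move=> mt vt mv; rewrite /rk -!size_filter.
  have <- : size (v :: filter (revlex_gt v) (mons t)) = (size (filter (revlex_gt v) (mons t))).+1 by [].
  apply: uniq_leq_size; first by rewrite /= mem_filter revlex_irr filter_uniq ?mons_uniq.
  move=> w; rewrite inE !mem_filter => /predU1P[->|/andP[vw ->]]; first by rewrite mv.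
  by rewrite (revlex_trans mv vw).
suff H k q : q \is t.-homog -> (forall m, m \in msupp q -> (rk m < k)%N) ->
  exists2 r, I (q - r) & forall m, m \in msupp r -> mdeg m = t /\ ~ Lead I m.
  move=> pt; apply: (H (size (mons t)).+1) => // m _; rewrite ltnS; exact: count_size.
elim: k q => [q _|k IHk q qt qk].
  have [->|/initial_monomial_exists[m [mq _]] /(_ m mq)//] := eqVneq q 0.
  by move=> _; exists 0; [rewrite subr0|move=> m; rewrite msupp0].
have [->|/initial_monomial_exists[m [mq maxm]]] := eqVneq q 0.
  by exists 0; [rewrite subr0|move=> m; rewrite msupp0].
have mt : mdeg m = t by move/homog_partP: qt; exact.
have mt' : m \in mons t by rewrite mem_mons mt.
have red f : f \is t.-homog -> initial_monomial f m ->
    exists2 r, I (q - q@_m / f@_m *: f - r) & forall m, m \in msupp r -> mdeg m = t /\ ~ Lead I m.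
  move=> ft [mf maxf]; have fm0 : f@_m != 0 by rewrite -mcoeff_msupp.
  have rt : q - q@_m / f@_m *: f \is t.-homog.
    by rewrite rpredB ?rpredZ.
  apply: IHk => // v vr; have vt : mdeg v = t by move/homog_partP: rt; exact.
  have vm : v != m.
    apply: contraTneq vr => ->; rewrite mcoeff_msupp mcoeffB mcoeffZ divfK //.
    by rewrite subrr eqxx.
  rewrite -ltnS; apply: leq_trans (qk _ mq); rewrite ltnS; apply: rk_lt => //; first by rewrite mem_mons vt.
  move/msuppB_le: vr; rewrite mem_cat => /orP[/maxm|/msuppZ_le/maxf]; exact.
have [Lm|nLm] := pselect (Lead I m).
  have [f If [ft fm]] := Lead_homog gI Lm; rewrite mt in ft.
  have [r Ir rP] := red f ft fm; exists r => //.
  have -> : q - r = (q - q@_m / f@_m *: f - r) + q@_m / f@_m *: f.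
    by rewrite addrAC subrK.
  by apply: ID => //; apply: ideal_scale.
(* A standard m is not reduced: its term is split off, and given back to the remainder
   afterwards. *)
have [r Ir rP] : exists2 r, I (q - q@_m / ('X_[m] : R)@_m *: 'X_[m] - r) &
    forall v, v \in msupp r -> mdeg v = t /\ ~ Lead I v.
  apply: red; first by rewrite dhomogX; apply/eqP.
  by split=> [|v /mem_msuppXP <-]; rewrite ?eqxx // msuppX mem_head.
rewrite mcoeffX eqxx divr1 in Ir; exists (r + q@_m *: 'X_[m]).
  by rewrite opprD addrA addrAC.
move=> v /msuppD_le; rewrite mem_cat => /orP[/rP//|/msuppZ_le/mem_msuppXP <-].
by split.
Qed.

(** Macaulay's basis theorem. Standard monomials are independent modulo I because a nonzero
    combination lying in I would have a standard monomial as its initial monomial. *)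
Lemma dim_quot_standard I t : graded_ideal I ->
  dim_quot (homog_part t) I (count (fun m => `[<~ Lead I m>]) (mons t)).
Proof.
move=> gI; have [idI _] := gI; rewrite -size_filter.
set s := filter _ _; have us : uniq s by rewrite filter_uniq ?mons_uniq.
have memn (i : 'I_(size s)) : nth 0%MM s i \in s by exact: mem_nth.
have sP m : m \in s <-> mdeg m = t /\ ~ Lead I m.
  rewrite mem_filter mem_mons; split=> [/andP[/asboolP ? /eqP]|[/eqP -> ?]] //.
  by rewrite andbT; exact/asboolP.
have coefs (c : 'I_(size s) -> K) (i : 'I_(size s)) :
    (\sum_j c j *: 'X_[nth 0%MM s j] : R)@_(nth 0%MM s i) = c i.
  rewrite raddf_sum (bigD1 i) //= mcoeffZ mcoeffX eqxx mulr1 big1 ?addr0 //.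
  by move=> j ji; rewrite mcoeffZ mcoeffX nth_uniq // -[nat_of_ord j == i]/(j == i) (negbTE ji) mulr0.
exists (fun i => 'X_[nth 0%MM s i]); split=> [i|c Ic i|p pt].
- by rewrite /homog_part /= dhomogX; have [/eqP ] := (sP _).1 (memn i).
- have [f0|/initial_monomial_exists[m mf]] := eqVneq (\sum_j c j *: 'X_[nth 0%MM s j] : R) 0.
    by rewrite -(coefs c i) f0 mcoeff0.
  have Lm : Lead I m by exists (\sum_j c j *: 'X_[nth 0%MM s j]).
  case: mf => /msupp_sum_le; rewrite filter_predT => /flatten_mapP[j _].
  by move=> /msuppZ_le/mem_msuppXP mE _; have [_] := (sP _).1 (memn j); rewrite mE.
- have [q Iq qP] := standard_span gI pt; exists (fun i : 'I_(size s) => q@_(nth 0%MM s i)).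
  suff -> : \sum_(i < size s) q@_(nth 0%MM s i) *: 'X_[nth 0%MM s i] = q by [].
  apply/mpolyP => m; have [ms|nms] := boolP (m \in s).
    have := coefs (fun i : 'I_(size s) => q@_(nth 0%MM s i)) (Ordinal (etrans (index_mem m s) ms)).
    by rewrite /= nth_index.
  have -> : q@_m = 0 by apply: memN_msupp_eq0; apply: contraNN nms => /qP/sP.
  rewrite raddf_sum big1 //= => i _; rewrite mcoeffZ mcoeffX.
  by case: eqP => [im|]; rewrite ?mulr0 //; rewrite -im memn in nms.
Qed.

Lemma hilbert_functionP I t : graded_ideal I ->
  hilbert_function I t = count (fun m => `[<~ Lead I m>]) (mons t).
Proof.
by move=> gI; apply: hilbert_functionE (dim_quot_standard t gI); case: gI.
Qed.

Lemma hilbert_function_initial_ideal I : graded_ideal I ->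
  hilbert_function (initial_ideal I) = hilbert_function I.
Proof.
move=> gI; apply/funext => t; rewrite !hilbert_functionP //.
  by rewrite Lead_initial_ideal //; case: gI.
exact: ideal_gen_graded.
Qed.

(** If each degree from 0 to k had a form outside I, these k + 1 forms would be independent modulo
    I, as I is graded, against dimension k. Once I contains all forms of one degree, it contains
    those of the next. *)
Lemma homog_part_exhausted I : graded_ideal I -> artinian I ->
  exists D, forall d, (D <= d)%N -> homog_part d `<=` I.
Proof.
move=> gI [k [b [_ _ span]]]; have [idI pI] := gI; have [_ _ IM] := idI.
have [t _ tI] : exists2 t, (t <= k)%N & homog_part t `<=` I.
  apply/not_exists2P => nI.
  have /choice[f fP] : forall t : 'I_k.+1, exists f : R, f \is t.-homog /\ ~ I f.
    move=> t; have [|nh] := nI t; first by rewrite -ltnS ltn_ord.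
    by apply: contrapT => nf; apply: nh => f ft; apply: contrapT => ?; apply: nf; exists f.
  suff: (k.+1 <= k)%N by rewrite ltnn.
  apply: (independent_leq_span (ideal_subspace idI) (b := b) (b' := f)).
    by move=> i; exact: span.
  move=> c /(pI _) + t => /(_ t).
  rewrite linear_sum (bigD1 t) //= big1 ?addr0; last first.
    move=> j jt; rewrite linearZ /= (pihomog_ne0 _ (fP j).1) ?scaler0 //.
  rewrite linearZ /= pihomog_dE ?(fP t).1 // => Ic.
  have [//|c0] := eqVneq (c t) 0; have [] := (fP t).2.
  by rewrite -[f t](scalerK c0); apply: ideal_scale.
exists t => d; elim: d => [|d IHd]; first by rewrite leqn0 => /eqP <-.
rewrite leq_eqVlt ltnS => /predU1P[<- //|/IHd dI] p /homog_partP pd.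
rewrite [p]mpolyE big_seq; apply: ideal_sum => // m /pd md; apply: ideal_scale => //.
have /existsP[i mi] : [exists i, (0 < m i)%N].
  apply: contra_eqT md; rewrite negb_exists => /forallP m0.
  by rewrite mdegE big1 // => i _; apply/eqP; rewrite -leqn0 leqNgt.
have Um : (U_(i) <= m)%MM by rewrite lep1mP -lt0n.
rewrite -(submK Um) addmC mpolyXD; apply: IM; apply: dI.
rewrite /homog_part /= dhomogX; apply/eqP/succn_inj.
by rewrite -md -[in RHS](submK Um) mdegD mdeg1 addn1.
Qed.

End Hilbert.

(** * Linear changes of coordinates *)

Section LinearSubstitution.
Variable n : nat.

(** Stated over a ring so that g may have polynomial entries, to be specialized later. *)
Definition linear_images (R : comNzRingType) (g : 'M[R]_n) : n.-tuple {mpoly R[n]} :=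
  [tuple \sum_(i < n) g i j *: 'X_i | j < n].

Lemma map_mpoly_monomial_subst (R S : comNzRingType) (f : {rmorphism R -> S}) (g : 'M[R]_n) m :
  map_mpoly f ('X_[m] \mPo linear_images g) = 'X_[m] \mPo linear_images (map_mx f g).
Proof.
rewrite !comp_mpolyX rmorph_prod; apply: eq_bigr => i _.
rewrite rmorphXn !tnth_mktuple rmorph_sum; congr (_ ^+ _).
by apply: eq_bigr => j _; rewrite mxE [LHS]map_mpolyZ map_mpolyX.
Qed.

End LinearSubstitution.

Section CoordChange.
Variables (K : fieldType) (n : nat).
Local Notation R := {mpoly K[n]}.
Implicit Types (I : set R) (p q : R) (g h : 'M[K]_n) (m : 'X_{1..n}).

Lemma coord_changeD g : {morph coord_change g : p q / p + q}.
Proof. by move=> p q; rewrite /coord_change raddfD. Qed.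

Lemma coord_changeB g : {morph coord_change g : p q / p - q}.
Proof. by move=> p q; rewrite /coord_change raddfB. Qed.

Lemma coord_changeM g : {morph coord_change g : p q / p * q}.
Proof. by move=> p q; rewrite /coord_change rmorphM. Qed.

Lemma coord_changeXn g p k : coord_change g (p ^+ k) = coord_change g p ^+ k.
Proof. by rewrite /coord_change rmorphXn. Qed.

Lemma coord_changeZ g c p : coord_change g (c *: p) = c *: coord_change g p.
Proof. exact: comp_mpolyZ. Qed.

Lemma coord_change_sum g (T : Type) (r : seq T) (P : pred T) (F : T -> R) :
  coord_change g (\sum_(i <- r | P i) F i) = \sum_(i <- r | P i) coord_change g (F i).
Proof. by rewrite /coord_change raddf_sum. Qed.

Lemma coord_change_prod g (T : Type) (r : seq T) (F : T -> R) :
  coord_change g (\prod_(i <- r) F i) = \prod_(i <- r) coord_change g (F i).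
Proof. by rewrite /coord_change rmorph_prod. Qed.

Lemma coord_changeXU g j : coord_change g 'X_j = \sum_i g i j *: 'X_i.
Proof. by rewrite /coord_change comp_mpolyXU -tnth_nth tnth_mktuple. Qed.

Lemma coord_changeX g m :
  coord_change g 'X_[m] = \prod_j (\sum_i g i j *: 'X_i) ^+ m j.
Proof.
by rewrite /coord_change comp_mpolyX; apply: eq_bigr => j _; rewrite tnth_mktuple.
Qed.

Lemma coord_change_mul h g p :
  coord_change h (coord_change g p) = coord_change (h *m g) p.
Proof.
rewrite [p]mpolyE (coord_change_sum g) (coord_change_sum h) coord_change_sum.
apply: eq_bigr => m _.
rewrite (coord_changeZ g) !coord_changeZ; congr (_ *: _); rewrite !coord_changeX.
rewrite coord_change_prod; apply: eq_bigr => j _.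
rewrite coord_changeXn coord_change_sum; congr (_ ^+ _).
under eq_bigr do rewrite coord_changeZ coord_changeXU scaler_sumr.
rewrite exchange_big; apply: eq_bigr => k _ /=.
by rewrite mxE scaler_suml; apply: eq_bigr => i _; rewrite scalerA mulrC.
Qed.

Lemma coord_change1 p : coord_change 1%:M p = p.
Proof.
rewrite -[RHS]comp_mpoly_id /coord_change; congr (_ \mPo _).
apply: eq_from_tnth => j; rewrite !tnth_mktuple (bigD1 j) //= mxE eqxx scale1r.
by rewrite big1 ?addr0 // => i ij; rewrite mxE (negbTE ij) scale0r.
Qed.

Lemma coord_changeK g : g \in unitmx -> cancel (coord_change g) (coord_change (invmx g)).
Proof. by move=> ug p; rewrite coord_change_mul mulVmx // coord_change1. Qed.

Lemma coord_changeVK g : g \in unitmx -> cancel (coord_change (invmx g)) (coord_change g).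
Proof. by move=> ug p; rewrite coord_change_mul mulmxV // coord_change1. Qed.

Lemma homog_prod_sum (T : Type) (r : seq T) (F : T -> R) (e : T -> nat) :
  (forall i, F i \is (e i).-homog) -> \prod_(i <- r) F i \is (\sum_(i <- r) e i)%N.-homog.
Proof.
move=> Fe; elim/big_rec2: _ => [|i d q _]; first exact: dhomog1.
exact: dhomogM.
Qed.

Lemma coord_change_homog g d p : p \is d.-homog -> coord_change g p \is d.-homog.
Proof.
move=> /homog_partP pd; rewrite [p]mpolyE coord_change_sum big_seq.
apply: rpred_sum => m /pd <-; rewrite coord_changeZ rpredZ // coord_changeX mdegE.
apply: homog_prod_sum => j; rewrite -[X in X.-homog]mul1n; apply: dhomogMn.
by apply: rpred_sum => i _; rewrite rpredZ // dhomogX /= mdeg1.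
Qed.

Lemma pihomog_coord_change g d p :
  pihomog mdeg d (coord_change g p) = coord_change g (pihomog mdeg d p).
Proof.
(* The bound k makes p a finite sum of components; the degrees d >= k, where both sides vanish, are
   treated apart. *)
have [k pk] : exists k, (msize p <= k)%N by exists (msize p).
rewrite [in LHS](pihomog_partitionE pk) coord_change_sum linear_sum /=.
have piE (i : nat) : pihomog mdeg d (coord_change g (pihomog mdeg i p)) =
  if i == d then coord_change g (pihomog mdeg d p) else 0.
  case: eqP => [->|/eqP id].
    by rewrite pihomog_dE // coord_change_homog // pihomogP.
  by rewrite (pihomog_ne0 id) // coord_change_homog // pihomogP.
under eq_bigr do rewrite piE; rewrite -big_mkcond /=.
have [dk|kd] := ltnP d k; first by rewrite (big_pred1 (Ordinal dk)).
rewrite big_pred0 => [|i]; last by apply: ltn_eqF; apply: leq_trans kd.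
rewrite (_ : pihomog mdeg d p = 0) ?/coord_change ?comp_mpoly0 //.
apply/mpolyP => m; rewrite mcoeff0 mcoeff_pihomog; case: eqP => // md.
by apply/memN_msupp_eq0/msize_mdeg_ge; rewrite md; apply: leq_trans kd.
Qed.

Lemma coord_change_graded g I : g \in unitmx -> graded_ideal I ->
  graded_ideal (coord_change g @` I).
Proof.
move=> ug [[I0 ID IM] gI]; split; last first.
  move=> d _ [p Ip <-]; rewrite pihomog_coord_change.
  by exists (pihomog mdeg d p) => //; exact: gI.
split=> [|_ _ [p Ip <-] [q Iq <-]|p _ [q Iq <-]].
- by exists 0; rewrite // /coord_change comp_mpoly0.
- by exists (p + q); rewrite ?coord_changeD //; exact: ID.
- exists (coord_change (invmx g) p * q); first exact: IM.
  by rewrite coord_changeM coord_changeVK.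
Qed.

Lemma coord_change_image g I p : g \in unitmx ->
  (coord_change g @` I) (coord_change g p) <-> I p.
Proof.
move=> ug; split=> [[q Iq]|Ip]; last by exists p.
by move/(can_inj (coord_changeK ug)) <-.
Qed.

Lemma hilbert_function_coord_change g I : g \in unitmx -> graded_ideal I ->
  hilbert_function (coord_change g @` I) = hilbert_function I.
Proof.
move=> ug gI; apply/funext => t; have [gidI _] := coord_change_graded ug gI.
rewrite [RHS]hilbert_functionP //; apply: hilbert_functionE => //.
have [b [bt indep span]] := dim_quot_standard t gI.
have sumE c : coord_change g (\sum_i c i *: b i) = \sum_i c i *: coord_change g (b i).
  by rewrite coord_change_sum; apply: eq_bigr => i _; rewrite coord_changeZ.
exists (fun i => coord_change g (b i)); split=> [i|c|p pt].
- exact: coord_change_homog (bt i).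
- by rewrite -sumE coord_change_image // => /indep.
- have [c Ic] := span _ (coord_change_homog (invmx g) pt); exists c.
  rewrite -[p](coord_changeVK ug) -sumE -coord_changeB.
  exact/coord_change_image.
Qed.

End CoordChange.

(** * Forms of degree d as row vectors *)

Section Coordinates.
Variable n : nat.

Definition mon d (i : 'I_(size (mons n d))) : 'X_{1..n} := nth 0%MM (mons n d) i.

Lemma mdeg_mon d (i : 'I_(size (mons n d))) : mdeg (mon i) = d.
Proof. by apply/eqP; rewrite -mem_mons mem_nth. Qed.

Lemma mon_inj d : injective (@mon d).
Proof. by move=> i j /eqP; rewrite nth_uniq ?mons_uniq // => /eqP/val_inj. Qed.

Lemma monP d m : mdeg m = d -> exists i : 'I_(size (mons n d)), mon i = m.
Proof.
move=> md; have mM : m \in mons n d by rewrite mem_mons md.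
exists (Ordinal (etrans (index_mem m (mons n d)) mM)); exact: nth_index.
Qed.

(** The action of g on forms of degree d. It multiplies row vectors on the right, whence the
    reversed product in [subst_mxM]. *)
Definition subst_mx (R : comNzRingType) d (g : 'M[R]_n) : 'M[R]_(size (mons n d)) :=
  \matrix_(i, j) ('X_[mon i] \mPo linear_images g)@_(mon j).

Lemma map_subst_mx (R S : comNzRingType) (f : {rmorphism R -> S}) d (g : 'M[R]_n) :
  map_mx f (subst_mx d g) = subst_mx d (map_mx f g).
Proof.
by apply/matrixP => i j; rewrite !mxE -map_mpoly_monomial_subst mcoeff_map_mpoly.
Qed.

Variable K : fieldType.
Implicit Types (I : set {mpoly K[n]}) (p q : {mpoly K[n]}) (g h : 'M[K]_n).

Definition coord d p : 'rV[K]_(size (mons n d)) := \row_j p@_(mon j).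

Definition form d (v : 'rV[K]_(size (mons n d))) : {mpoly K[n]} :=
  \sum_j v 0 j *: 'X_[mon j].

Lemma form_coeff d (v : 'rV[K]_(size (mons n d))) j : (form v)@_(mon j) = v 0 j.
Proof.
rewrite raddf_sum (bigD1 j) //= mcoeffZ mcoeffX eqxx mulr1 big1 ?addr0 //.
by move=> i ij; rewrite mcoeffZ mcoeffX (inj_eq (@mon_inj d)) (negbTE ij) mulr0.
Qed.

Lemma formK d : cancel (@form d) (coord d).
Proof. by move=> v; apply/rowP => j; rewrite mxE form_coeff. Qed.

Lemma form_homog d (v : 'rV[K]_(size (mons n d))) : form v \is d.-homog.
Proof.
by apply: rpred_sum => i _; rewrite rpredZ // dhomogX; apply/eqP/mdeg_mon.
Qed.

Lemma coordK d p : p \is d.-homog -> form (coord d p) = p.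
Proof.
move=> pd; apply/mpolyP => m; have [md|md] := eqVneq (mdeg m) d.
  by have [j <-] := monP md; rewrite form_coeff mxE.
by rewrite (dhomog_nemf_coeff (form_homog _) md) (dhomog_nemf_coeff pd md).
Qed.

Lemma form_is_linear d : linear (@form d).
Proof.
move=> c u v; rewrite /form scaler_sumr -big_split; apply: eq_bigr => j _ /=.
by rewrite !mxE scalerA -scalerDl.
Qed.

HB.instance Definition _ d := GRing.isLinear.Build K _ _ _ (@form d) (@form_is_linear d).

Lemma form_delta d j : form (delta_mx 0 j : 'rV_(size (mons n d))) = 'X_[mon j].
Proof.
rewrite /form (bigD1 j) //= mxE !eqxx scale1r big1 ?addr0 // => i ij.
by rewrite mxE eqxx (negbTE ij) scale0r.
Qed.

Lemma form_supp d (v : 'rV[K]_(size (mons n d))) m :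
  m \in msupp (form v) -> exists2 j, m = mon j & v 0 j != 0.
Proof.
move=> mv; have /homog_partP/(_ m mv)/monP[j jm] := form_homog v.
by exists j; rewrite // -form_coeff jm -mcoeff_msupp.
Qed.

Lemma coord_change_form d g (v : 'rV[K]_(size (mons n d))) :
  coord_change g (form v) = form (v *m subst_mx d g).
Proof.
rewrite /form coord_change_sum; under eq_bigr do rewrite coord_changeZ.
have X_form i : coord_change g 'X_[mon i] = form (row i (subst_mx d g)).
  rewrite -[LHS](@coordK d) ?coord_change_homog //; last first.
    by rewrite dhomogX; apply/eqP/mdeg_mon.
  by congr form; apply/rowP => j; rewrite !mxE.
under eq_bigr do rewrite X_form -linearZ; rewrite -linear_sum; congr form.
by rewrite mulmx_sum_row.
Qed.

Lemma subst_mxM d h g : subst_mx d (h *m g) = subst_mx d g *m subst_mx d h.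
Proof.
apply/row_matrixP => i; rewrite !rowE mulmxA.
have := coord_change_mul h g (form (delta_mx 0 i)).
rewrite (coord_change_form g) (coord_change_form h) (coord_change_form (h *m g)).
by move/(can_inj (@formK d)) => ->.
Qed.

Lemma subst_mx1 d : subst_mx d (1%:M : 'M[K]_n) = 1%:M.
Proof.
apply/row_matrixP => i; rewrite !rowE mulmx1.
by apply: (can_inj (@formK d)); rewrite -coord_change_form coord_change1.
Qed.

Lemma subst_mx_unit d g : g \in unitmx -> subst_mx d g \in unitmx.
Proof.
move=> ug; have : subst_mx d g *m subst_mx d (invmx g) = 1%:M.
  by rewrite -subst_mxM mulVmx // subst_mx1.
case/mulmx1_unit => uS _; exact: uS.
Qed.

(** Take B of maximal rank among the matrices with rows in W: adjoining a vector of W outside its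
    row space would raise the rank. *)
Lemma subspace_mxP N (W : set 'rV[K]_N) : subspace W ->
  exists B : 'M[K]_N, forall v, (v <= B)%MS <-> W v.
Proof.
move=> [W0 WD WZ].
pose P r := `[< exists2 B : 'M[K]_N, \rank B = r & forall v, (v <= B)%MS -> W v >].
have exP : exists r, P r.
  exists 0; apply/asboolP; exists 0; first exact: mxrank0.
  by move=> v; rewrite submx0 => /eqP ->.
have ubP r : P r -> (r <= N)%N by move=> /asboolP[B <- _]; exact: rank_leq_row.
case: (ex_maxnP exP ubP) => r /asboolP[B rB BW] maxr; exists B => v; split=> [/BW //|Wv].
apply: contrapT => /negP nvB.
suff /maxr : P (\rank (B + v)%MS).
  rewrite leqNgt -rB => /negP; apply; apply: rank_ltmx.
  by rewrite ltmxE addsmxSl addsmx_sub submx_refl (negbTE nvB).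
apply/asboolP; exists (B + v)%MS => // u /sub_addsmxP[[a b] /= ->].
apply: WD; first by apply: BW; exact: submxMl.
have [c ->] : exists c, b = c%:M by exists (b 0 0); exact: mx11_scalar.
by rewrite mul_scalar_mx; exact: WZ.
Qed.

End Coordinates.

(** * Semicontinuity of the rank and tangent directions *)

Section GenericRank.
Variable K : fieldType.

Lemma nonzero_minor (m n : nat) (M : 'M[K]_(m, n)) :
  exists f h, \det (mxsub f h M : 'M_(\rank M)) != 0.
Proof.
pose N := mxsub (maxrankfun M) id M.
have fullN : row_full N^T by rewrite /row_full mxrank_tr -/(row_free N) maxrowsub_free.
exists (maxrankfun M), (fullrankfun fullN); rewrite -unitfE -unitmxE.
by rewrite mxsubcr -[colsub _ _]trmxK unitmx_tr trmx_mxsub fullrowsub_unit.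
Qed.

Lemma minor_rank (m n r : nat) (M : 'M[K]_(m, n)) (f : 'I_r -> 'I_m) (h : 'I_r -> 'I_n) :
  \det (mxsub f h M) != 0 -> (r <= \rank M)%N.
Proof.
rewrite -unitfE -unitmxE -row_free_unit => /eqP <-.
rewrite mxsubcr -mxrank_tr trmx_mxsub.
have subrank (p q k : nat) (A : 'M[K]_(p, q)) (e : 'I_k -> 'I_p) :
    (\rank (mxsub e id A) <= \rank A)%N.
  by apply/mxrankS/row_subP => i; rewrite row_rowsub row_sub.
by apply: leq_trans (subrank _ _ _ _ _) _; rewrite mxrank_tr subrank.
Qed.

(** Take for p a minor of B of maximal size among those nonzero at [phi0]. The ring is arbitrary
    because both multivariate evaluations and evaluations of {poly K} occur as specializations. *)
Lemma rank_specialization (R : comNzRingType) (phi0 : {rmorphism R -> K}) (m n : nat)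
    (B : 'M[R]_(m, n)) :
  exists2 p : R, phi0 p != 0 & forall phi : {rmorphism R -> K}, phi p != 0 ->
    (\rank (map_mx phi0 B) <= \rank (map_mx phi B))%N.
Proof.
have [f [h dfh]] := nonzero_minor (map_mx phi0 B).
exists (\det (mxsub f h B)) => [|phi]; rewrite -det_map_mx map_mxsub //.
exact: minor_rank.
Qed.

Lemma generic_rank (N m n : nat) (B : 'M[{mpoly K[N]}]_(m, n)) :
  exists2 p : {mpoly K[N]}, p != 0 & forall v : 'I_N -> K, p.@[v] != 0 ->
    forall w : 'I_N -> K, (\rank (map_mx (meval w) B) <= \rank (map_mx (meval v) B))%N.
Proof.
pose P r := `[< exists w : 'I_N -> K, \rank (map_mx (meval w) B) = r >].
have exP : exists r, P r by exists (\rank (map_mx (meval (fun=> 0)) B)); apply/asboolP; exists (fun=> 0).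
have ubP r : P r -> (r <= m)%N by move=> /asboolP[w <-]; exact: rank_leq_row.
case: (ex_maxnP exP ubP) => r /asboolP[w0 rB] maxr.
have [p pw0 pP] := rank_specialization (meval w0) B.
exists p => [|v pv w]; first by apply: contraNneq pw0 => ->; rewrite rmorph0.
apply: leq_trans (pP _ pv); rewrite rB; apply: maxr; apply/asboolP; by exists w.
Qed.

Hypothesis charK0 : [pchar K] =i pred0.

Lemma natr_injective : injective (fun i : nat => i%:R : K).
Proof.
have /pcharf0P K0 := charK0.
suff H i j : (i <= j)%N -> i%:R = j%:R :> K -> i = j.
  by move=> i j ij; case/orP: (leq_total i j) => /H-> //.
move=> leij ij; apply/eqP; rewrite eqn_leq leij -subn_eq0 -K0 natrB // ij subrr.
exact: eqxx.
Qed.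

Lemma poly_nonroot (q : {poly K}) : q != 0 -> exists t, q.[t] != 0.
Proof.
move=> q0; apply: contrapT => nt.
pose rs := [seq i%:R : K | i <- iota 0 (size q)].
have /(max_poly_roots q0) : all (root q) rs.
  apply/allP => x _; apply/rootP/eqP; apply: contrapT => /negP qx; apply: nt; by exists x.
rewrite map_inj_uniq ?iota_uniq; last exact: natr_injective.
by rewrite size_map size_iota ltnn => /(_ isT).
Qed.

(** Induction on n: [muni] reads p as a polynomial in the last variable. A point where one of its
    coefficients is nonzero leaves a nonzero univariate polynomial, which has a nonroot. *)
Lemma mpoly_nonroot n (p : {mpoly K[n]}) : p != 0 -> exists v : 'I_n -> K, p.@[v] != 0.
Proof.
elim: n p => [|n IHn] p p0.
  exists (fun=> 0); rewrite (nvar0_mpolyC p) mevalC.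
  by apply: contraNneq p0 => p00; rewrite (nvar0_mpolyC p) p00 mpolyC0.
have [m mp] : exists m, m \in msupp p.
  by move: p0; rewrite -msupp_eq0; case: msupp => // m s _; exists m; rewrite mem_head.
pose widen_mnm (u : 'X_{1..n.+1}) := [multinom u (widen_ord (leqnSn n) i) | i < n].
have cE : ((muni p)`_(m ord_max))@_(widen_mnm m) = p@_m.
  rewrite muniE coef_sum raddf_sum /= (bigD1_seq m) ?msupp_uniq //=.
  rewrite -/(widen_mnm m) !coefZ coefXn eqxx mulr1 mcoeffZ mcoeffX eqxx mulr1.
  rewrite big1 ?addr0 // => u um; rewrite -/(widen_mnm u) coefZ coefXn.
  have [em|_] := eqVneq (m ord_max) (u ord_max); last by rewrite mulr0 mcoeff0.
  rewrite mulr1 mcoeffZ mcoeffX; case: eqP => [/mnmP eu|]; rewrite ?mulr0 //.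
  case/eqP: um; apply/mnmP => i; have [j ->|->//] := unliftP ord_max i.
  have := eu j; rewrite !mnmE.
  by rewrite (_ : widen_ord _ j = lift ord_max j) //; apply: val_inj; rewrite /= /bump leqNgt ltn_ord.
have /IHn[v vP] : (muni p)`_(m ord_max) != 0.
  by apply: contraTneq mp => e; rewrite mcoeff_msupp -cE e mcoeff0 eqxx.
have /poly_nonroot[t qt] : map_poly (meval v) (muni p) != 0.
  apply: contraNneq vP => q0; have := coef_map (meval v) (muni p) (m ord_max).
  by rewrite q0 coef0 => <-.
exists (fun i => if unlift ord_max i is Some j then v j else t).
suff <- : (map_poly (meval v) (muni p)).[t] = p.@[fun i => if unlift ord_max i is Some j then v j else t].
  by [].
rewrite muniE rmorph_sum horner_sum mevalE; apply: eq_bigr => u _ /=.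
rewrite big_ord_recr /= unlift_none -!mul_polyC -mul_mpolyC !rmorphM /=.
rewrite !map_polyC map_polyXn !hornerM !hornerC hornerXn /= mevalC mevalX mulrA.
congr (_ * _ * _); apply: eq_bigr => i _; rewrite mnmE.
by rewrite (_ : widen_ord _ i = lift ord_max i) ?liftK //; apply: val_inj; rewrite /= /bump leqNgt ltn_ord.
Qed.

(* The tangent space at B0 of the matrices of rank at most \rank B0. If v B1
   were not in the row space of B0, then for generic t the row
   v B(t) / t = v B1 + t v Z(t) would increase the rank of B(t). *)
Lemma tangent_rank (m n : nat) (B0 B1 : 'M[K]_(m, n)) (Z : 'M[{poly K}]_(m, n)) :
  (forall t, \rank (B0 + t *: B1 + t ^+ 2 *: map_mx (horner_eval t) Z)%R <= \rank B0)%N ->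
  forall v : 'rV_m, v *m B0 = 0 -> (v *m B1 <= B0)%MS.
Proof.
move=> maxB0 v vB0; apply: contrapT => /negP nvB1.
have /submxP[P PB0] : (row_base B0 <= B0)%MS by rewrite eq_row_base.
pose cst k l (A : 'M[K]_(k, l)) := map_mx polyC A.
have evC t k l (A : 'M[K]_(k, l)) : map_mx (horner_eval t) (cst _ _ A) = A.
  by apply/matrixP => i j; rewrite !mxE /horner_eval hornerC.
(* [P] extracts a basis of the row space of [B0]; at t = 0 the rows of [M] span that space together
   with [v *m B1]. *)
pose M : 'M[{poly K}]_(\rank B0 + 1, n) :=
  col_mx (cst _ _ P *m (cst _ _ B0 + 'X *: cst _ _ B1 + 'X ^+ 2 *: Z))
         (cst _ _ (v *m B1) + 'X *: (cst _ _ v *m Z)).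
have evM t : map_mx (horner_eval t) M =
    col_mx (P *m (B0 + t *: B1 + t ^+ 2 *: map_mx (horner_eval t) Z))
           (v *m B1 + t *: (v *m map_mx (horner_eval t) Z)).
  rewrite map_col_mx !(map_mxM, map_mxD, map_mxZ, evC).
  by rewrite rmorphXn /= /horner_eval hornerX.
have rM0 : (\rank B0 < \rank (map_mx (horner_eval 0) M))%N.
  rewrite evM expr0n /= !scale0r !addr0 -PB0 -addsmxE.
  apply: (@rank_ltmx _ _ _ _ B0); rewrite ltmxE addsmx_sub eq_row_base submx_refl.
  by rewrite (submx_trans _ (addsmxSl _ _)) ?eq_row_base //=; apply/negP.
have [p p0 pP] := rank_specialization (horner_eval 0) M.
(* The factor ['X] makes t nonzero, so that t times the last row of [M] lies in the row space of
   B(t). *)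
have /poly_nonroot[t] : p * 'X != 0.
  by rewrite mulf_neq0 ?polyX_eq0 //; apply: contraNneq p0 => ->; rewrite rmorph0.
rewrite hornerM hornerX mulf_eq0 negb_or => /andP[pt t0].
have := leq_trans rM0 (pP (horner_eval t) pt); rewrite ltnNge => /negP; apply.
apply: leq_trans (maxB0 t); apply: mxrankS; rewrite evM col_mx_sub.
apply/andP; split; first exact: submxMl.
rewrite -(eqmx_scale _ t0) scalerDr scalerA -expr2 !scalemxAr.
by rewrite -[X in (X <= _)%MS]add0r -vB0 addrA -!mulmxDr submxMl.
Qed.

End GenericRank.

(** * Generic coordinates and existence of the generic initial ideal *)

Section GenericChange.
Variables (K : fieldType) (n : nat).
Local Notation R := {mpoly K[n]}.
Implicit Types (I : set R) (p q : R) (g h : 'M[K]_n) (m : 'X_{1..n}).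
Local Notation dim d := (size (mons n d)).

(** The projection to the coordinates in T, kept square so that no reindexing by T is involved. *)
Definition mask N (T : {set 'I_N}) : 'M[K]_N := diag_mx (\row_j (j \in T)%:R).

Lemma mul_maskE k N (A : 'M[K]_(k, N)) (T : {set 'I_N}) i j :
  (A *m mask T) i j = if j \in T then A i j else 0.
Proof. by rewrite mul_mx_diag !mxE; case: ifP; rewrite ?mulr1 ?mulr0. Qed.

Lemma mul_mask_eq0 N (v : 'rV[K]_N) (T : {set 'I_N}) :
  v *m mask T = 0 <-> forall j, j \in T -> v 0 j = 0.
Proof.
split=> [/rowP vT j jT|vT]; first by have:= vT j; rewrite mul_maskE jT mxE.
by apply/rowP => j; rewrite mul_maskE mxE; case: ifP => // /vT.
Qed.

(* The default value 0 is not used when I is an ideal. *)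
Definition part_mx I d : 'M[K]_(dim d) :=
  xget 0 [set B : 'M[K]_(dim d) | forall v, (v <= B)%MS <-> I (form v)].

Lemma part_mxP I d (v : 'rV_(dim d)) : is_ideal I -> (v <= part_mx I d)%MS <-> I (form v).
Proof.
move=> idI; rewrite /part_mx; case: xgetP => [B _ /(_ v) //|none].
have [I0 ID _] := idI.
suff [B BP] : exists B : 'M[K]_(dim d), forall v, (v <= B)%MS <-> I (form v).
  by have := none B.
apply: (subspace_mxP (W := [set v | I (form v)])); split=> /= [|u w|c u].
- by rewrite linear0.
- by rewrite linearD; exact: ID.
- by rewrite linearZ; exact: ideal_scale.
Qed.

Definition image_mx I g d : 'M[K]_(dim d) := part_mx I d *m subst_mx d g.

Lemma image_mxP I g d (v : 'rV_(dim d)) : is_ideal I -> g \in unitmx ->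
  (v <= image_mx I g d)%MS <-> (coord_change g @` I) (form v).
Proof.
move=> idI ug; have uS := subst_mx_unit d ug.
rewrite -[v in (v <= _)%MS](mulmxKV uS) /image_mx submxMfree ?row_free_unit //.
rewrite part_mxP // -(coord_change_image _ _ ug) coord_change_form.
by rewrite mulmxKV.
Qed.

Lemma mxrank_image I g d : g \in unitmx -> \rank (image_mx I g d) = \rank (part_mx I d).
Proof. by move=> ug; rewrite mxrankMfree // row_free_unit subst_mx_unit. Qed.

(* The only genericity condition that is imposed on g. For T an upper set of
   the revlex order these ranks count initial monomials, and for T the
   monomials not divisible by the s-th power of the last variable they decide
   whether multiplication by this power has full rank. *)
Definition maximal_ranks I D g : Prop :=
  forall d, (d < D)%N -> forall (T : {set 'I_(dim d)}) h,
    (\rank (image_mx I h d *m mask T) <= \rank (image_mx I g d *m mask T))%N.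

Definition entries g : 'I_(n * n) -> K := mxvec g ord0.

Definition generic_mx : 'M[{mpoly K[n * n]}]_n := \matrix_(i, j) 'X_(mxvec_index i j).

Lemma eval_generic_mx g : map_mx (meval (entries g)) generic_mx = g.
Proof. by apply/matrixP => i j; rewrite !mxE mevalXU /entries mxvecE. Qed.

(** [generic_rank] gives one polynomial for each pair of a degree d < D and a set T. There are
    finitely many pairs, so the product of these polynomials works. *)
Lemma maximal_ranks_generic I D : exists2 p : {mpoly K[n * n]}, p != 0 &
  forall g, p.@[entries g] != 0 -> maximal_ranks I D g.
Proof.
have evC g k l (A : 'M[K]_(k, l)) : map_mx (meval (entries g)) (map_mx (@mpolyC _ _) A) = A.
  by apply/matrixP => i j; rewrite !mxE mevalC.
pose good d (T : {set 'I_(dim d)}) (p : {mpoly K[n * n]}) :=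
  p != 0 /\ forall g, p.@[entries g] != 0 -> forall h,
    (\rank (image_mx I h d *m mask T) <= \rank (image_mx I g d *m mask T))%N.
have ex_good d (T : {set 'I_(dim d)}) : exists r : {mpoly K[n * n]}, good d T r.
  pose B := map_mx (@mpolyC _ _) (part_mx I d) *m subst_mx d generic_mx *m map_mx (@mpolyC _ _) (mask T).
  have evB g : map_mx (meval (entries g)) B = image_mx I g d *m mask T.
    by rewrite !map_mxM !evC map_subst_mx eval_generic_mx.
  have [r r0 rP] := @generic_rank K (n * n) _ _ B.
  exists r; split; first exact: r0.
  move=> g rg h.
  by have := rP _ rg (entries h); rewrite (evB h) (evB g).
pose r d (T : {set 'I_(dim d)}) := projT1 (cid (ex_good d T)).
have rP d T : good d T (r d T) by rewrite /r; case: cid.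
exists (\prod_(d < D) \prod_(T : {set 'I_(dim d)}) r d T).
  by apply/prodf_neq0 => d _; apply/prodf_neq0 => T _; have [] := rP d T.
move=> g; rewrite rmorph_prod => /prodf_neq0 rg d dD T h.
have := rg (Ordinal dD) isT; rewrite rmorph_prod => /prodf_neq0 /(_ T isT) /= rgT.
by have [_ H] := rP d T; exact: (H g rgT h).
Qed.

Hypothesis charK0 : [pchar K] =i pred0.

(** The product of p, of a polynomial q nonzero somewhere on U, and of the generic determinant is a
    nonzero polynomial, hence has a nonroot. *)
Lemma zariski_open_dense (U : set 'M[K]_n) (p : {mpoly K[n * n]}) :
  zariski_open U -> U !=set0 -> p != 0 -> exists2 g, U g & p.@[entries g] != 0.
Proof.
move=> [P ->] [h [_ [q Pq qh]]] p0.
have q0 : q != 0 by apply: contraNneq qh => ->; rewrite rmorph0.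
have det0 : \det generic_mx != 0.
  have : (\det generic_mx).@[entries 1%:M] != 0 by rewrite -det_map_mx eval_generic_mx det1 oner_neq0.
  by apply: contraNneq => ->; rewrite rmorph0.
have /(mpoly_nonroot charK0)[v] : p * q * \det generic_mx != 0 by rewrite !mulf_neq0.
pose g : 'M[K]_n := vec_mx (\row_i v i).
have -> : meval v =1 meval (entries g).
  by move=> r; apply: meval_eq => i; rewrite /entries vec_mxK mxE.
rewrite !rmorphM /= -det_map_mx eval_generic_mx !mulf_eq0 !negb_or -!andbA => /and3P[pg qg dg].
by exists g => //; split; [rewrite unitmxE unitfE|exists q].
Qed.

Lemma Lead_imageP I g d (i : 'I_(dim d)) : graded_ideal I -> g \in unitmx ->
  Lead (coord_change g @` I) (mon i) <->
  exists2 v : 'rV_(dim d), (v <= image_mx I g d)%MS &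
    v 0 i != 0 /\ forall j, revlex_gt (mon j) (mon i) -> v 0 j = 0.
Proof.
move=> gI ug; have [idI _] := gI; split.
  move=> /(Lead_homog (coord_change_graded ug gI))[f If []]; rewrite mdeg_mon => fd [mf maxf].
  exists (coord d f); first by apply/image_mxP; rewrite ?coordK.
  split=> [|j ji]; first by rewrite mxE -mcoeff_msupp.
  rewrite mxE; apply: memN_msupp_eq0; apply/negP => /maxf.
  have [e|_ /(_ isT) ij] := eqVneq (mon j) (mon i); first by rewrite e revlex_irr in ji.
  by have := revlex_trans ji ij; rewrite revlex_irr.
move=> [v /image_mxP vI [vi vP]]; exists (form v); first exact: vI.
split; first by rewrite mcoeff_msupp form_coeff.
move=> _ /form_supp[j -> vj] /revlex_total/orP[/vP v0|//].
by rewrite v0 eqxx in vj.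
Qed.

Lemma Lead_image_rank I g d (i : 'I_(dim d)) : graded_ideal I -> g \in unitmx ->
  let T := finset (fun j : 'I_(dim d) => revlex_gt (mon j) (mon i)) in
  Lead (coord_change g @` I) (mon i) <->
  (\rank (image_mx I g d *m mask T) < \rank (image_mx I g d *m mask (i |: T)))%N.
Proof.
move=> gI ug T; rewrite Lead_imageP //; set A := image_mx I g d.
have rankE T' : \rank (A *m mask T') = (\rank A - \rank (A :&: kermx (mask T')))%N.
  by rewrite -(mxrank_mul_ker A (mask T')) addnK.
have memA (v : 'rV_(dim d)) T' : (v <= A :&: kermx (mask T'))%MS <->
    (v <= A)%MS /\ forall j, j \in T' -> v 0 j = 0.
  rewrite sub_capmx; split=> [/andP[vA /sub_kermxP/mul_mask_eq0]|[-> vT]] //=.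
  exact/sub_kermxP/mul_mask_eq0.
have sub : (A :&: kermx (mask (i |: T)) <= A :&: kermx (mask T))%MS.
  apply/rV_subP => v /memA[vA vT]; apply/memA; split=> // j jT.
  by apply: vT; rewrite !inE in jT *; rewrite jT orbT.
have leA T' : (\rank (A :&: kermx (mask T')) <= \rank A)%N by apply: mxrankS; exact: capmxSl.
rewrite !rankE ltn_sub2lE ?leA //; split=> [[v vA [vi vP]]|].
  apply: rank_ltmx; rewrite ltmxE sub; apply/negP => /(submx_trans (_ : (v <= _)%MS)) vT.
  have /memA[_ /(_ i)] : (v <= A :&: kermx (mask (i |: T)))%MS.
    by apply: vT; apply/memA; split=> // j; rewrite inE => /vP.
  by rewrite setU11 => /(_ isT)/eqP; rewrite (negbTE vi).
move=> lt; apply: contrapT => nv; move: lt; rewrite ltnNge => /negP; apply.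
apply/mxrankS/rV_subP => v /memA[vA vT]; apply/memA; split=> // j.
rewrite in_setU1 => /predU1P[->|/vT //]; apply: contrapT => /eqP vi.
by apply: nv; exists v => //; split=> // k ki; apply: vT; rewrite inE.
Qed.

Lemma Lead_image_large I D f m : (forall d, (D <= d)%N -> homog_part d `<=` I) ->
  f \in unitmx -> (D <= mdeg m)%N -> Lead (coord_change f @` I) m.
Proof.
move=> DI uf Dm; exists 'X_[m].
  rewrite -['X_[m]](coord_changeVK uf); apply/coord_change_image => //.
  by apply: (DI _ Dm); apply: coord_change_homog; rewrite dhomogX.
by split=> [|v /mem_msuppXP <-]; rewrite ?eqxx // msuppX mem_head.
Qed.

Lemma Lead_image_maximal I D g h : graded_ideal I -> g \in unitmx -> h \in unitmx ->
  (forall d, (D <= d)%N -> homog_part d `<=` I) ->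
  maximal_ranks I D g -> maximal_ranks I D h ->
  Lead (coord_change g @` I) = Lead (coord_change h @` I).
Proof.
move=> gI ug uh DI mg mh.
have eq_rank d T : (d < D)%N ->
    \rank (image_mx I g d *m mask T) = \rank (image_mx I h d *m mask T).
  by move=> dD; apply/eqP; rewrite eqn_leq; apply/andP; split; [exact: mh|exact: mg].
have eq_Lead d (i : 'I_(dim d)) : (d < D)%N ->
    Lead (coord_change g @` I) (mon i) <-> Lead (coord_change h @` I) (mon i).
  move=> dD; pose T := finset (fun j : 'I_(dim d) => revlex_gt (mon j) (mon i)).
  split=> [/(Lead_image_rank i gI ug)|/(Lead_image_rank i gI uh)] /= lt_rank.
    by apply/(Lead_image_rank i gI uh); rewrite -(eq_rank d T dD) -(eq_rank d (i |: T) dD).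
  by apply/(Lead_image_rank i gI ug); rewrite (eq_rank d T dD) (eq_rank d (i |: T) dD).
apply/funext => m; apply/propext; have [Dm|mD] := leqP D (mdeg m).
  by split=> _; exact: Lead_image_large DI _ Dm.
by have [i <-] := monP (erefl (mdeg m)); exact: eq_Lead.
Qed.

Lemma zariski_open_nonzero (p : {mpoly K[n * n]}) :
  zariski_open [set g : 'M[K]_n | g \in unitmx /\ p.@[entries g] != 0].
Proof.
exists [set p]; apply/seteqP; split=> g [ug pg]; split=> //; first by exists p.
by case: pg => _ ->.
Qed.

Lemma zariski_open_GL : zariski_open [set g : 'M[K]_n | g \in unitmx].
Proof.
exists [set 1]; apply/seteqP; split=> g; last by case.
by move=> ug; split=> //; exists 1; rewrite // rmorph1 oner_neq0.
Qed.

Lemma is_gin_gin I : graded_ideal I -> artinian I -> is_gin I (gin I).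
Proof.
move=> gI aI; have [D DI] := homog_part_exhausted gI aI.
suff [J ginJ] : exists J, is_gin I J by rewrite /gin; case: xgetP => // none; case: (none J).
have [p p0 pP] := maximal_ranks_generic I D.
have [|g0 ug0 pg0] := zariski_open_dense zariski_open_GL _ p0.
  by exists 1%:M; exact: unitmx1.
exists (initial_ideal (coord_change g0 @` I)).
exists [set g : 'M[K]_n | g \in unitmx /\ p.@[entries g] != 0]; split.
- exact: zariski_open_nonzero.
- by exists g0.
- move=> g [ug pg]; congr (ideal_gen (monomials _)).
  exact: (Lead_image_maximal gI ug ug0 DI (pP g pg) (pP g0 pg0)).
Qed.

(** The open set that comes with [gin I] need not lie in the locus of maximal ranks, but density
    provides a g in both. *)
Lemma gin_generic I D : graded_ideal I -> artinian I ->
  exists g, [/\ g \in unitmx, maximal_ranks I D g & initial_ideal (coord_change g @` I) = gin I].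
Proof.
move=> gI aI; have [U [oU U0 UJ]] := is_gin_gin gI aI.
have [p p0 pP] := maximal_ranks_generic I D.
have [g Ug pg] := zariski_open_dense oU U0 p0; exists g; split.
- by case: oU Ug => P -> [].
- exact: pP.
- exact: UJ.
Qed.

End GenericChange.

(** * Stability of the initial monomials under Borel moves *)

Section BorelMove.
Variables (K : fieldType) (n : nat).
Hypothesis charK0 : [pchar K] =i pred0.
Implicit Types (I : set {mpoly K[n]}) (g : 'M[K]_n).
Local Notation dim d := (size (mons n d)).

Lemma exprD_mod_square (R : comNzRingType) (a b t : R) k :
  exists z, (a + t * b) ^+ k = a ^+ k + t * (b * a ^+ k.-1 *+ k) + t ^+ 2 * z.
Proof.
elim: k => [|k [z IHk]]; first by exists 0; rewrite !expr0 mulr0n !mulr0 !addr0.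
exists (a * z + b * (b * a ^+ k.-1 *+ k) + t * b * z).
rewrite exprS IHk; case: k {IHk} => [|k]; first by rewrite !expr0 expr1 mulr0n mulr1n; ring.
by rewrite /= !exprS; ring.
Qed.

(** Columns hold the images of the variables: x_j goes to x_j + t x_i and the other variables are
    fixed. *)
Definition transvection (R : comNzRingType) (i j : 'I_n) (t : R) : 'M[R]_n :=
  1%:M + t *: delta_mx i j.

(** The linear term is x_i times the derivative by x_j. When [m j = 0] the subtraction of exponents
    is truncated, but the multiplicity [m j] then kills the term. *)
Lemma mpolyX_transvection (R : comNzRingType) (i j : 'I_n) (t : R) m :
  exists z, 'X_[m] \mPo linear_images (transvection i j t) =
    'X_[m] + t *: ('X_[m - U_(j) + U_(i)] *+ m j) + t ^+ 2 *: z.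
Proof.
have imE k : tnth (linear_images (transvection i j t)) k =
    'X_k + (if k == j then t *: 'X_i else 0).
  rewrite tnth_mktuple; under eq_bigr do rewrite !mxE scalerDl.
  rewrite big_split /= (bigD1 k) //= eqxx scale1r big1 ?addr0; last first.
    by move=> l lk; rewrite (negbTE lk) scale0r.
  congr (_ + _); rewrite (bigD1 i) //= eqxx big1 ?addr0; last first.
    by move=> l li; rewrite (negbTE li) mulr0 scale0r.
  by case: (k == j); rewrite ?mulr1 ?mulr0 ?scale0r.
have XE (u : 'X_{1..n}) : 'X_[u] = 'X_j ^+ u j * \prod_(k < n | k != j) 'X_k ^+ u k :> {mpoly R[n]}.
  by rewrite mpolyXE_id (bigD1 j).
rewrite comp_mpolyX (bigD1 j) //= imE eqxx.
under eq_bigr => k kj do rewrite imE (negbTE kj) addr0.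
set P := \prod_(k < n | k != j) _; rewrite -mul_mpolyC.
have [z ->] := exprD_mod_square ('X_j : {mpoly R[n]}) 'X_i t%:MP (m j); exists (z * P).
have -> : 'X_[m - U_(j) + U_(i)] *+ m j = 'X_i * 'X_j ^+ (m j).-1 *+ m j * P :> {mpoly R[n]}.
  rewrite mpolyXD XE mnmBE mnm1E eqxx subn1 -mulrnAl mulrC mulrA mulrnAl.
  rewrite mulrnAl; congr (_ * _ *+ _); apply: eq_bigr => k kj.
  by rewrite mnmBE mnm1E eq_sym (negbTE kj) subn0.
by rewrite (XE m) -/P -!mul_mpolyC rmorphXn /= !mulrDl !mulrA.
Qed.

Lemma revlex_borel (i j : 'I_n) (u : 'X_{1..n}) : (i < j)%N -> (0 < u j)%N ->
  [/\ mdeg (u - U_(j) + U_(i))%MM = mdeg u, (u - U_(j) + U_(i) + U_(j) = u + U_(i))%MM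
    & revlex_gt (u - U_(j) + U_(i))%MM u].
Proof.
move=> ij uj; have Uu : (U_(j) <= u)%MM by rewrite lep1mP -lt0n.
have E : (u - U_(j) + U_(i) + U_(j) = u + U_(i))%MM.
  by rewrite -addmA [(U_(i) + _)%MM]addmC addmA submK.
split=> //; first by apply/eqP; rewrite -(eqn_add2r 1) -{1}(mdeg1 j) -mdegD E mdegD mdeg1.
rewrite -(revlex_add2r U_(j)) E ![(u + _)%MM]addmC revlex_add2r.
apply/revlexP; first by rewrite !mdeg1.
exists j => [|k jk]; rewrite !mnm1E ?eqxx.
  by rewrite -val_eqE /= (ltn_eqF ij).
by rewrite -!val_eqE /= (ltn_eqF jk) (ltn_eqF (ltn_trans ij jk)).
Qed.

(** The expansion is made once with the indeterminate of {poly K} as parameter, so that one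
    polynomial remainder Z serves all t, as [tangent_rank] requires. *)
Lemma subst_mx_transvection d (i j : 'I_n) : exists Z : 'M[{poly K}]_(dim d), forall t,
  subst_mx d (transvection i j t) = 1%:M
    + t *: (\matrix_(k, l) ((mon k j)%:R *+ (mon l == mon k - U_(j) + U_(i))%MM))
    + t ^+ 2 *: map_mx (horner_eval t) Z.
Proof.
have /choice[z zP] : forall k : 'I_(dim d), exists z : {mpoly {poly K}[n]},
    'X_[mon k] \mPo linear_images (transvection i j 'X) = 'X_[mon k]
      + 'X *: ('X_[mon k - U_(j) + U_(i)] *+ mon k j) + 'X ^+ 2 *: z.
  by move=> k; exact: mpolyX_transvection.
exists (\matrix_(k, l) (z k)@_(mon l)) => t.
have <- : map_mx (horner_eval t) (transvection i j 'X) = transvection i j t.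
  by apply/matrixP => k l; rewrite !mxE /horner_eval !(hornerE, hornerMn).
rewrite -map_subst_mx; apply/matrixP => k l; rewrite !mxE zP !mcoeffD !mcoeffZ mcoeffMn !mcoeffX.
rewrite /= /horner_eval !(hornerE, hornerMn) (inj_eq (@mon_inj _ _)) [mon l == _]eq_sym.
by rewrite -mulrnA mulnC mulrnA.
Qed.

(* Let f in g(I) have initial monomial u. Composing g with x_j |-> x_j + t x_i
   cannot increase the rank of the projection of the degree d part of g(I) to
   the monomials >= u' = u x_i / x_j. As f projects to 0, so does its derivative
   at t = 0 modulo the image of g(I); this derivative is x_i * (df / dx_j), and its
   projection is a multiple of u', with the factor u_j that is nonzero in
   characteristic zero. *)
Lemma Lead_image_borel I D g (i j : 'I_n) (u : 'X_{1..n}) : graded_ideal I -> g \in unitmx ->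
  (forall d, (D <= d)%N -> homog_part d `<=` I) -> maximal_ranks I D g ->
  (i < j)%N -> (0 < u j)%N -> Lead (coord_change g @` I) u ->
  Lead (coord_change g @` I) (u - U_(j) + U_(i))%MM.
Proof.
move=> gI ug DI mg ij uj Lu; have [du' eu' gu'] := revlex_borel ij uj.
have [Dd|dD] := leqP D (mdeg u); first by apply: Lead_image_large DI _ _; rewrite ?du'.
set d := mdeg u in du' dD; have [k ku] := monP (erefl d); have [k' ku'] := monP du'.
rewrite -ku'; rewrite -ku in Lu uj eu' gu' ku'; rewrite -ku' in eu' gu'; apply/Lead_imageP => //.
have [v vA [vk vP]] := (Lead_imageP _ gI ug).1 Lu.
pose A := image_mx I g d; rewrite -/A in vA *.
pose T := finset (fun l : 'I_(dim d) => ~~ revlex_gt (mon k') (mon l)).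
have [Z ZP] := subst_mx_transvection d i j.
set E1 : 'M_(dim d) := \matrix_(_, _) _ in ZP.
have rank_le t : (\rank (A *m mask K T + t *: (A *m E1 *m mask K T)
    + t ^+ 2 *: map_mx (horner_eval t) (map_mx polyC A *m Z *m map_mx polyC (mask K T)))%R
    <= \rank (A *m mask K T))%N.
  have evC k1 k2 (B : 'M[K]_(k1, k2)) : map_mx (horner_eval t) (map_mx polyC B) = B.
    by apply/matrixP => x y; rewrite !mxE /horner_eval hornerC.
  have := mg d dD T (transvection i j t *m g).
  rewrite {1}/image_mx subst_mxM ZP mulmxA -/(image_mx I g d) -/A !map_mxM !evC.
  by rewrite !mulmxDr mulmx1 -!scalemxAr !mulmxDl -!scalemxAl.
have {rank_le} tangent := tangent_rank charK0 rank_le.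
have [w vE] := submxP vA.
have in_T l : l \in T -> l = k' \/ revlex_gt (mon l) (mon k').
  rewrite inE; have [lk|lk] := eqVneq (mon l) (mon k'); first by left; exact: mon_inj lk.
  by case/orP: (revlex_total lk) => [|->//]; right.
have vT : v *m mask K T = 0.
  apply/mul_mask_eq0 => l /in_T[->|lk']; apply: vP => //.
  exact: revlex_trans lk' gu'.
(* The move respects the revlex order: every other monomial of v contributes zero or is sent below
   u'. So on T only u contributes. *)
have vE1 l : l \in T -> (v *m E1) 0 l = v 0 k * (mon k j)%:R *+ (l == k').
  move=> /in_T lT; rewrite mxE (bigD1 k) //= big1 ?addr0; last first.
    move=> k2 k2k; rewrite mxE; have [->|v0] := eqVneq (v 0 k2) 0; first by rewrite mul0r.
    have [->|m0] := posnP (mon k2 j); first by rewrite mul0rn mulr0.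
    case: eqP => [lE|]; rewrite ?mulr0n ?mulr0 //.
    have gk2 : revlex_gt (mon k) (mon k2).
      have /revlex_total/orP[//|/vP v0'] : mon k != mon k2 by rewrite (inj_eq (@mon_inj _ _)) eq_sym.
      by rewrite v0' eqxx in v0.
    have [_ eu2 _] := revlex_borel ij m0; rewrite -lE in eu2.
    have gk'l : revlex_gt (mon k') (mon l).
      by rewrite -(revlex_add2r U_(j)) eu2 eu' revlex_add2r.
    case: lT => [e|gl]; first by rewrite e revlex_irr in gk'l.
    by have := revlex_trans gl gk'l; rewrite revlex_irr.
  by rewrite mxE -ku' (inj_eq (@mon_inj _ _)) -mulrnAr.
have /submxP[w2 w2E] : (w *m (A *m E1 *m mask K T) <= A *m mask K T)%MS.
  by apply: tangent; rewrite mulmxA -vE.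
have w2T l : l \in T -> (w2 *m A) 0 l = v 0 k * (mon k j)%:R *+ (l == k').
  move=> lT; rewrite -vE1 //; move/rowP/(_ l): w2E.
  by rewrite [w *m _]mulmxA [w *m _]mulmxA -vE [w2 *m _]mulmxA !mul_maskE lT => ->.
exists (w2 *m A); first exact: submxMl.
split=> [|l lk']; last first.
  rewrite w2T; last by rewrite inE; apply/negP => /(revlex_trans lk'); rewrite revlex_irr.
  by case: eqP => // e; rewrite e revlex_irr in lk'.
rewrite w2T ?inE ?revlex_irr // eqxx mulf_neq0 //.
by have /pcharf0P -> := charK0; rewrite -lt0n.
Qed.

End BorelMove.

(** * Transfer of the Lefschetz property to the last variable *)

Section StrongLefschetz.
Variables (K : fieldType) (n : nat).
Implicit Types (I : set {mpoly K[n]}) (g : 'M[K]_n).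
Local Notation dim d := (size (mons n d)).

(** Rank normal form of the column c: its right factor is a nonzero scalar a, its middle factor the
    first unit vector. It remains to invert the left factor, divide by a, and swap the first index
    with o. *)
Lemma cV_to_delta (c : 'cV[K]_n) (o : 'I_n) : c != 0 ->
  exists2 g : 'M[K]_n, g \in unitmx & g *m c = delta_mx o 0.
Proof.
move=> c0; have rc : \rank c = 1%N.
  by apply/eqP; rewrite eqn_leq rank_leq_col lt0n mxrank_eq0.
have c_col : c = col_ebase c *m pid_mx 1 *m row_ebase c by rewrite -[LHS]mulmx_ebase rc.
have [a aE] : exists a, row_ebase c = a%:M by exists (row_ebase c 0 0); exact: mx11_scalar.
have a0 : a != 0.
  have := row_ebase_unit c; rewrite aE unitmxE det_scalar1 unitfE; exact.
pose i0 : 'I_n := Ordinal (leq_ltn_trans (leq0n o) (ltn_ord o)).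
have pidE : pid_mx 1 = delta_mx i0 0 :> 'cV[K]_n.
  by apply/matrixP => i j; rewrite !mxE ord1 eqxx andbT -val_eqE /=; case: (val i) => [|[]].
exists (a^-1 *: (tperm_mx o i0 *m invmx (col_ebase c))).
  by rewrite unitmxZ ?unitfE ?invr_eq0 // unitmx_mul unitmx_perm unitmx_inv col_ebase_unit.
rewrite [X in _ *m X = _]c_col aE mul_mx_scalar -scalemxAl -scalemxAr scalerA mulVf // scale1r.
rewrite -mulmxA mulKmx ?col_ebase_unit // pidE -xrowE.
apply/matrixP => i j; rewrite /xrow /row_perm !mxE; congr ((_ && _)%:R).
by rewrite -{2}(tpermL o i0) (inj_eq perm_inj).
Qed.

Lemma SLP_coord_change I (o : 'I_n) : is_ideal I -> SLP I ->
  exists g, g \in unitmx /\ forall i s, (0 < s)%N ->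
    mul_injective (coord_change g @` I) ('X_o ^+ s) i \/
    mul_surjective (coord_change g @` I) ('X_o ^+ s) i (i + s).
Proof.
move=> idI [l l1 lSL]; have [I0 ID IM] := idI.
(* If l = 0, each multiplication map has a zero source or a zero target, so that
   every linear form is a Lefschetz element. *)
have [l0|lN0] := eqVneq l 0.
  exists 1%:M; split=> [|i s s0]; first exact: unitmx1.
  have -> : coord_change 1%:M @` I = I.
    apply/seteqP; split=> [_ [p Ip <-]|p Ip]; first by rewrite coord_change1.
    by exists p; rewrite ?coord_change1.
  have := lSL i s s0; rewrite l0 expr0n eqn0Ngt s0 /= => -[inj|surj]; [left|right].
    by move=> p q pi qi _; apply: inj => //; rewrite !mul0r subrr.
  move=> q qi; exists 0; first exact: dhomog0.
  by have [p _] := surj q qi; rewrite mul0r mulr0.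
pose c : 'cV[K]_n := \col_j l@_U_(j).
have lE : l = \sum_j c j 0 *: 'X_j.
  apply/mpolyP => m; have [/mdeg1P[j /eqP ->]|m1] := boolP (mdeg m == 1%N).
    rewrite raddf_sum (bigD1 j) //= mcoeffZ mcoeffXU eqxx mulr1 mxE big1 ?addr0 //.
    by move=> k kj; rewrite mcoeffZ mcoeffXU (negbTE kj) mulr0.
  rewrite (dhomog_nemf_coeff l1 m1) raddf_sum big1 //= => j _.
  rewrite mcoeffZ mcoeffX; case: eqP => [e|]; rewrite ?mulr0 //.
  by rewrite -e mdeg1 in m1.
have [|g ug gc] := @cV_to_delta c o.
  by apply: contraNneq lN0 => c0; rewrite lE big1 // => j _; rewrite c0 mxE scale0r.
exists g; split=> // i s s0.
have glE : coord_change g l = 'X_o.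
  rewrite lE coord_change_sum; under eq_bigr do rewrite coord_changeZ coord_changeXU scaler_sumr.
  rewrite exchange_big (bigD1 o) //=.
  have coefE k : \sum_j c j 0 *: (g k j *: 'X_k : {mpoly K[n]}) = (k == o)%:R *: 'X_k.
    under eq_bigr do rewrite scalerA mulrC; rewrite -scaler_suml.
    by have := congr1 (fun M : 'cV_n => M k 0) gc; rewrite !mxE andbT => ->.
  rewrite coefE eqxx scale1r big1 ?addr0 // => k ko.
  by rewrite coefE (negbTE ko) scale0r.
have VX : coord_change (invmx g) 'X_o = l by rewrite -glE coord_changeK.
have transfer p : (coord_change g @` I) p <-> I (coord_change (invmx g) p).
  by rewrite -[p in X in X <-> _](coord_changeVK ug) coord_change_image.
have [inj|surj] := lSL i s s0; [left|right].
  move=> p q pi qi /transfer; rewrite coord_changeB !coord_changeM coord_changeXn VX => Ipq.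
  by apply/transfer; rewrite coord_changeB; apply: inj => //; exact: coord_change_homog.
move=> q qi; have [p pi Ip] := surj _ (coord_change_homog (invmx g) qi).
exists (coord_change g p); first exact: coord_change_homog.
by apply/transfer; rewrite coord_changeB coord_changeM coord_changeXn VX coord_changeK.
Qed.

Definition shift_mx (o : 'I_n) s i N : 'M[K]_(dim i, dim N) :=
  \matrix_(k, l) (mon l == mon k + U_(o) *+ s)%MM%:R.

Lemma shift_mxE o s i N (w : 'rV_(dim i)) k l : mon l = (mon k + U_(o) *+ s)%MM ->
  (w *m shift_mx o s i N) 0 l = w 0 k.
Proof.
move=> lE; rewrite mxE (bigD1 k) //= mxE lE eqxx mulr1 big1 ?addr0 // => k2 k2k.
by rewrite mxE lE eqm_add2r (inj_eq (@mon_inj _ _)) eq_sym (negbTE k2k) mulr0.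
Qed.

Lemma mdegDU_muln (o : 'I_n) s (m : 'X_{1..n}) : mdeg (m + U_(o) *+ s)%MM = (mdeg m + s)%N.
Proof. by rewrite mdegD mdegMn mdeg1 mul1n. Qed.

Lemma shift_index (o : 'I_n) s i (k : 'I_(dim i)) :
  exists l : 'I_(dim (i + s)), mon l = (mon k + U_(o) *+ s)%MM.
Proof. by apply: monP; rewrite mdegDU_muln mdeg_mon. Qed.

Lemma shift_index_inv (o : 'I_n) s i (l : 'I_(dim (i + s))) : (s <= mon l o)%N ->
  exists k : 'I_(dim i), mon l = (mon k + U_(o) *+ s)%MM.
Proof.
move=> so; have Ul : (U_(o) *+ s <= mon l)%MM.
  apply/mnm_lepP => j; rewrite mulmnE mnm1E.
  by case: eqVneq => [<-|_]; rewrite ?mul1n ?mul0n.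
have [|k kE] := @monP n i (mon l - U_(o) *+ s)%MM; last by exists k; rewrite kE submK.
by apply/eqP; rewrite -(eqn_add2r s) -(mdegDU_muln o) submK // mdeg_mon.
Qed.

Lemma shift_mx_free (o : 'I_n) s i : row_free (shift_mx o s i (i + s)).
Proof.
rewrite -kermx_eq0; apply/eqP/row_matrixP => r; rewrite row0.
have : row r (kermx (shift_mx o s i (i + s))) *m shift_mx o s i (i + s) = 0.
  by rewrite -row_mul mulmx_ker row0.
move: (row r _) => w /rowP wS; apply/rowP => k; have [l lE] := shift_index o s k.
by rewrite -(shift_mxE w lE) wS !mxE.
Qed.

Lemma form_shift (o : 'I_n) s i (w : 'rV_(dim i)) :
  form (w *m shift_mx o s i (i + s)) = 'X_o ^+ s * form w.
Proof.
apply/mpolyP => m; have [md|md] := eqVneq (mdeg m) (i + s)%N; last first.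
  rewrite (dhomog_nemf_coeff (form_homog _) md); apply/esym/eqP.
  have /dhomog_nemf_coeff-> // : 'X_o ^+ s * form w \is (i + s).-homog.
  rewrite addnC dhomogM ?form_homog // -[s in s.-homog]mul1n dhomogMn //.
  by rewrite dhomogX; apply/eqP/mdeg1.
have [l lE] := monP md; rewrite -lE form_coeff mpolyXn.
have [so|os] := leqP s (mon l o); last first.
  rewrite mxE big1 => [|k _]; last first.
    rewrite mxE; case: eqP => [lE'|]; rewrite ?mulr0 //.
    by rewrite lE' mnmDE mulmnE mnm1E eqxx mul1n ltnNge leq_addl in os.
  apply/esym/memN_msupp_eq0; rewrite mulrC (perm_mem (msuppMX _ _)).
  apply/mapP => -[u _ lE']; move: os.
  by rewrite lE' mnmDE mulmnE mnm1E eqxx mul1n ltnNge leq_addr.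
have [k kE] := shift_index_inv so.
by rewrite (shift_mxE w kE) kE mulrC addmC mcoeffMX form_coeff.
Qed.

Lemma shift_mx_image I g (o : 'I_n) s i : is_ideal I -> g \in unitmx ->
  (image_mx I g i *m shift_mx o s i (i + s) <= image_mx I g (i + s))%MS.
Proof.
move=> idI ug; apply/rV_subP => _ /submxP[u ->]; apply/(image_mxP _ idI ug).
rewrite mulmxA form_shift; set f := form _.
have [p Ip <-] : (coord_change g @` I) f by apply/(image_mxP _ idI ug); exact: submxMl.
exists (coord_change (invmx g) 'X_o ^+ s * p); first by case: idI => _ _; exact.
by rewrite coord_changeM coord_changeXn coord_changeVK.
Qed.

Lemma not_divisible_mask (o : 'I_n) s i (v : 'rV[K]_(dim (i + s))) :
  let T := finset (fun l : 'I_(dim (i + s)) => (mon l o < s)%N) in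
  v *m mask K T = 0 <-> (v <= shift_mx o s i (i + s))%MS.
Proof.
move=> T; rewrite mul_mask_eq0; split=> [vT|/submxP[w ->] l]; last first.
  rewrite inE => os; rewrite mxE big1 // => k _; rewrite mxE.
  case: eqP => [lE|]; rewrite ?mulr0 //.
  by rewrite lE mnmDE mulmnE mnm1E eqxx mul1n ltnNge leq_addl in os.
rewrite [v]row_sum_delta; apply: summx_sub => l _.
have [lT|] := boolP (l \in T); first by rewrite vT // scale0r sub0mx.
rewrite inE -leqNgt => so; apply: scalemx_sub.
have [k kE] := shift_index_inv so.
suff <- : row k (shift_mx o s i (i + s)) = delta_mx 0 l by exact: row_sub.
apply/rowP => l'; rewrite !mxE eqxx /=; congr (_%:R).
by rewrite -kE (inj_eq (@mon_inj _ _)).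
Qed.

(* In degree i + s the projection of g(I) to the monomials not divisible by x_o ^ s
   has kernel g(I) :&: (x_o ^ s), which contains x_o ^ s g(I)_i. So its rank is
   bounded by the number of these monomials, and by \dim I_(i + s) - \dim I_i;
   the first bound is attained iff multiplication by x_o ^ s is surjective, the
   second iff it is injective. The bounds do not depend on g, hence full rank at
   g0 passes to g by maximality. *)
Lemma Lead_image_SL I D g (o : 'I_n) : graded_ideal I -> SLP I -> g \in unitmx ->
  (forall d, (D <= d)%N -> homog_part d `<=` I) -> maximal_ranks I D g ->
  (forall j : 'I_n, (j <= o)%N) -> forall i s, (0 < s)%N ->
  (forall w, mdeg w = (i + s)%N -> (w o < s)%N -> Lead (coord_change g @` I) w) \/
  (forall m, mdeg m = i -> Lead (coord_change g @` I) (m + U_(o) *+ s)%MM ->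
    Lead (coord_change g @` I) m).
Proof.
move=> gI slpI ug DI mg maxo i s s0; have [idI _] := gI.
have [Ds|sD] := leqP D (i + s).
  by left=> w dw _; apply: Lead_image_large DI ug _; rewrite dw.
have [g0 [ug0 /(_ i s s0) SL0]] := SLP_coord_change o idI slpI.
pose T := finset (fun l : 'I_(dim (i + s)) => (mon l o < s)%N).
pose A := image_mx I g (i + s); pose A0 := image_mx I g0 (i + s).
pose S := shift_mx o s i (i + s).
have maxA : (\rank (A0 *m mask K T) <= \rank (A *m mask K T))%N by exact: mg.
have T_gt (l : 'I_(dim (i + s))) v : mdeg v = (i + s)%N -> (v o < s)%N ->
    revlex_gt (mon l) v -> l \in T.
  move=> dv vs; rewrite inE => lv; apply: leq_ltn_trans vs.
  by apply: revlex_last_leq lv; rewrite ?mdeg_mon.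
case: SL0 => [inj|surj]; [right|left].
- have cap0 : (A0 :&: kermx (mask K T) <= image_mx I g0 i *m S)%MS.
    apply/rV_subP => v; rewrite sub_capmx => /andP[vA0 /sub_kermxP vT].
    have /submxP[w wE] : (v <= S)%MS by apply/not_divisible_mask.
    move: vA0; rewrite wE => /(image_mxP _ idI ug0); rewrite form_shift => Xw.
    apply: submxMr; apply/(image_mxP _ idI ug0); rewrite -[form w]subr0.
    by apply: inj; rewrite /homog_part /= ?form_homog ?dhomog0 // mulr0 subr0.
  have capA : (image_mx I g i *m S <= A :&: kermx (mask K T))%MS.
    rewrite sub_capmx shift_mx_image //=; apply/sub_kermxP/row_matrixP => r.
    by rewrite row0 row_mul; apply/not_divisible_mask; rewrite row_mul submxMl.
  (* [A] and [A0] have the same rank, so the larger projection of [A] has the smaller kernel; by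
     [cap0] this kernel is no larger than its subspace in [capA]. *)
  have cap : (A :&: kermx (mask K T) <= image_mx I g i *m S)%MS.
    rewrite -(geq_leqif (mxrank_leqif_sup capA)) (mxrankMfree _ (shift_mx_free _ _ _)) mxrank_image //.
    rewrite -(mxrank_image _ _ ug0) -(mxrankMfree _ (shift_mx_free o s i)).
    apply: leq_trans (mxrankS cap0).
    have rA : \rank A = \rank A0 by exact: etrans (mxrank_image I _ ug) (esym (mxrank_image I _ ug0)).
    have rkA := mxrank_mul_ker A (mask K T); have rkA0 := mxrank_mul_ker A0 (mask K T).
    have leq_summand a b c e r : (a + b = r -> c + e = r -> c <= a -> b <= e)%N.
      by move=> abr cer ca; rewrite -(leq_add2l a) abr -cer leq_add2r.
    exact: leq_summand rkA (etrans rkA0 (esym rA)) maxA.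
  move=> m mi; have [k km] := monP mi; have [l lE] := shift_index o s k.
  rewrite -km -lE => /(Lead_imageP _ gI ug)[v vA [vl vP]].
  (* The initial monomial of v is divisible by x_o ^ s, hence smaller than every monomial of T. So v
     vanishes on T and is x_o ^ s times an element of g(I). *)
  have /submxP[w wE] : (v <= image_mx I g i *m S)%MS.
    apply: submx_trans cap; rewrite sub_capmx vA; apply/sub_kermxP/mul_mask_eq0 => j.
    rewrite inE => js; apply: vP; apply: (@revlex_last_lt _ o) => //; first by rewrite !mdeg_mon.
    by apply: leq_trans js _; rewrite lE mnmDE mulmnE mnm1E eqxx mul1n leq_addl.
  apply/Lead_imageP => //; exists (w *m image_mx I g i); first exact: submxMl.
  split=> [|k2 k2k]; first by rewrite -(shift_mxE _ lE) -mulmxA -wE.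
  have [l2 l2E] := shift_index o s k2; rewrite -(shift_mxE _ l2E) -mulmxA -wE.
  by apply: vP; rewrite lE l2E revlex_add2r.
(* By surjectivity each monomial of T is, modulo multiples of x_o ^ s, an element of g0(I), and the
   mask kills these multiples. *)
- have T0 : (mask K T <= A0 *m mask K T)%MS.
    apply/row_subP => k; rewrite rowE.
    have -> : delta_mx 0 k *m mask K T = (if k \in T then delta_mx 0 k else 0) :> 'rV_(dim (i + s)).
      apply/rowP => l; rewrite mul_maskE; case: ifP => lT; case: ifP => kT; rewrite !mxE //.
        by rewrite eqxx /=; case: eqVneq => // e; rewrite -e lT in kT.
      by rewrite eqxx /=; case: eqVneq => // e; rewrite -e lT in kT.
    case: ifP => [kT|_]; last exact: sub0mx.
    have [|p pi Ip] := surj 'X_[mon k]; first by rewrite /homog_part /= dhomogX; apply/eqP/mdeg_mon.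
    rewrite -(coordK pi) -form_shift -form_delta -linearB in Ip.
    have /(image_mxP _ idI ug0)/submxP[w wE] := Ip.
    have wS : coord i p *m S *m mask K T = 0 by apply/not_divisible_mask; exact: submxMl.
    suff -> : delta_mx 0 k = w *m (A0 *m mask K T) by exact: submxMl.
    rewrite mulmxA -wE mulmxBl -/S wS subr0; apply/rowP => l; rewrite mul_maskE.
    by case: ifP => // lT; rewrite !mxE eqxx /=; case: eqVneq => // e; rewrite e kT in lT.
  have TA : (mask K T <= A *m mask K T)%MS.
    rewrite -(geq_leqif (mxrank_leqif_sup (submxMl A (mask K T)))).
    exact: leq_trans (mxrankS T0) maxA.
  move=> w dw ws; have [k kw] := monP dw; rewrite -kw in ws *.
  have kT : k \in T by rewrite inE.
  have /submxP[u uE] : ((delta_mx 0 k : 'rV[K]_(dim (i + s))) *m mask K T <= A *m mask K T)%MS.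
    exact: submx_trans (submxMl _ _) TA.
  have uT l : l \in T -> (u *m A) 0 l = (l == k)%:R.
    by move=> lT; move/rowP/(_ l): uE; rewrite mulmxA !mul_maskE lT mxE eqxx.
  (* The only monomial of T occurring in [u *m A] is w, and by [T_gt] all larger monomials belong to
     T. *)
  apply/Lead_imageP => //; exists (u *m A); first exact: submxMl.
  split=> [|l lk]; first by rewrite uT // eqxx oner_neq0.
  rewrite uT; last by apply: T_gt lk; rewrite ?mdeg_mon.
  by case: eqP => // e; rewrite e revlex_irr in lk.
Qed.

End StrongLefschetz.

(** * Almost revlex ideals and the Hilbert function *)

Section AlmostRevlex.
Variables (K : fieldType) (n : nat).
Local Notation R := {mpoly K[n]}.
Implicit Types (J : set R) (S G L : set 'X_{1..n}) (u v m : 'X_{1..n}).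

Lemma leqm_mdeg_eq u v : (u <= v)%MM -> (mdeg v <= mdeg u)%N -> u = v.
Proof.
move=> uv; rewrite -(submK uv) mdegD -[leqRHS]add0n leq_add2r leqn0 mdeg_eq0.
by move=> /eqP ->; rewrite add0m.
Qed.

Definition minimal_elements L : set 'X_{1..n} :=
  [set u | L u /\ forall v, L v -> (v <= u)%MM -> v = u].

Lemma upset_minimal_elements L : upset (minimal_elements L) = upset L.
Proof.
apply/seteqP; split=> m [s Ss sm]; first by exists s => //; case: Ss.
have [k sk] : exists k, (mdeg s < k)%N by exists (mdeg s).+1.
elim: k => // k IHk in s Ss sm sk *.
have [|] := pselect (forall v, L v -> (v <= s)%MM -> v = s); first by exists s.
move=> /existsNP[v /not_implyP[Lv /not_implyP[vs nvs]]].
apply: (IHk v) => //; first exact: lepm_trans vs sm.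
rewrite ltnS in sk; apply: leq_trans sk; rewrite ltnNge; apply/negP => sv.
exact/nvs/leqm_mdeg_eq.
Qed.

(** Any generating subset has an element dividing a given minimal u; that element lies in L, hence
    equals u. *)
Lemma minimal_generators L : upset L = L ->
  minimal_monomial_generators (ideal_gen (monomials (K := K) L)) (minimal_elements L).
Proof.
move=> upL; split; first by rewrite !ideal_genE upset_minimal_elements.
move=> G' subG eqG'; apply/seteqP; split=> // u [Lu minu].
have : ideal_gen (monomials (K := K) L) 'X_[u] by apply/ideal_gen_monomial; rewrite upL.
rewrite eqG' => /ideal_gen_monomial[s G's su].
by rewrite -(minu s _ su) //; have [] := subG s G's.
Qed.

(* A monomial of degree d in one ideal but not in the other is a generator. If m and m'
   are such monomials for the two ideals and m > m', then m belongs to both. *)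
Lemma almost_revlex_sub (G G' : set 'X_{1..n}) d :
  (forall u v, G u -> mdeg v = mdeg u -> revlex_gt v u -> upset G v) ->
  (forall u v, G' u -> mdeg v = mdeg u -> revlex_gt v u -> upset G' v) ->
  (forall m, (mdeg m < d)%N -> upset G m <-> upset G' m) ->
  count (fun m => `[<~ upset G m>]) (mons n d) = count (fun m => `[<~ upset G' m>]) (mons n d) ->
  forall m, mdeg m = d -> upset G m -> upset G' m.
Proof.
have new (H H' : set 'X_{1..n}) m : (forall m, (mdeg m < d)%N -> upset H m <-> upset H' m) ->
    mdeg m = d -> upset H m -> ~ upset H' m -> H m.
  move=> IH md [s Hs sm] nH'm; have [ms|lt_sm] := leqP (mdeg m) (mdeg s).
    by rewrite -(leqm_mdeg_eq sm ms).
  have [s' H's' s's] : upset H' s.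
    by apply/(IH s); [rewrite -md|exists s => //; exact: lepm_refl].
  by case: nH'm; exists s' => //; exact: lepm_trans s's sm.
move=> rG rG' IH eq_count m md Gm; apply: contrapT => nG'm.
(* Otherwise the complement of [upset G] in degree d lies in that of [upset G']; equal counts make
   them coincide, although m separates them. *)
have [m' [m'd G'm' nGm']] : exists m', [/\ mdeg m' = d, upset G' m' & ~ upset G m'].
  apply: contrapT => none; rewrite -!size_filter in eq_count.
  have sub : {subset [seq m <- mons n d | `[<~ upset G m>]] <= [seq m <- mons n d | `[<~ upset G' m>]]}.
    move=> w; rewrite !mem_filter mem_mons => /andP[/asboolP nGw /eqP wd].
    by rewrite wd eqxx andbT; apply/asboolP => G'w; apply: none; exists w.
  have [_ /(_ m)] := uniq_min_size (filter_uniq _ (mons_uniq n d)) sub (eq_leq (esym eq_count)).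
  rewrite !mem_filter mem_mons md eqxx !andbT => eqm.
  have /asboolP : `[<~ upset G m>] by rewrite eqm; exact/asboolP.
  exact.
have mm' : m != m' by apply: contra_notN nG'm => /eqP ->.
have Gm0 := new _ _ _ IH md Gm nG'm.
have G'm'0 : G' m' by apply: new m'd G'm' nGm' => w wd; apply: iff_sym; exact: IH.
case/orP: (revlex_total mm') => [gt|gt]; first by apply/nG'm/(rG' m') => //; rewrite m'd.
by apply/nGm'/(rG m) => //; rewrite m'd.
Qed.

Lemma almost_revlex_unique (J J' : set R) : almost_revlex J -> almost_revlex J' ->
  hilbert_function J = hilbert_function J' -> J = J'.
Proof.
move=> [G [JE _] rG] [G' [JE' _] rG'] eqH; rewrite JE in rG eqH *; rewrite JE' in rG' eqH *.
have {}rG u v : G u -> mdeg v = mdeg u -> revlex_gt v u -> upset G v.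
  by move=> Gu dv vu; apply/ideal_gen_monomial; exact: rG vu.
have {}rG' u v : G' u -> mdeg v = mdeg u -> revlex_gt v u -> upset G' v.
  by move=> Gu dv vu; apply/ideal_gen_monomial; exact: rG' vu.
have cnt d : count (fun m => `[<~ upset G m>]) (mons n d) = count (fun m => `[<~ upset G' m>]) (mons n d).
  have /(congr1 (fun f => f d)) := eqH.
  by rewrite !hilbert_functionP ?Lead_ideal_gen //; exact: ideal_gen_graded.
suff eqU k m : (mdeg m < k)%N -> upset G m <-> upset G' m.
  by rewrite !ideal_genE; congr mkset; apply/funext => p; apply/propext; split=> H m /H /eqU;
    apply; exact: ltnSn.
elim: k m => // k IHk m; rewrite ltnS leq_eqVlt => /predU1P[mk|/IHk //].
split; first exact: almost_revlex_sub rG rG' IHk (cnt k) m mk.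
have IHk' w : (mdeg w < k)%N -> upset G' w <-> upset G w by move=> wk; apply: iff_sym; exact: IHk.
exact: almost_revlex_sub rG' rG IHk' (esym (cnt k)) m mk.
Qed.

End AlmostRevlex.

(* Let v > u have the same degree, u a minimal generator, and c the exponent of x_3
   in u. If x_3 ^ c divides v, iterate the Borel move on u. Otherwise use the
   Lefschetz condition with s = c: its injectivity alternative would put u / x_3 ^ c
   in L. *)
Lemma almost_revlex_ideal_gen3 (K : fieldType) (L : set 'X_{1..3}) : upset L = L ->
  (forall (i j : 'I_3) (u : 'X_{1..3}), (i < j)%N -> (0 < u j)%N -> L u -> L (u - U_(j) + U_(i))%MM) ->
  (forall i s, (0 < s)%N ->
    (forall w : 'X_{1..3}, mdeg w = (i + s)%N -> (w ord_max < s)%N -> L w) \/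
    (forall m : 'X_{1..3}, mdeg m = i -> L (m + U_(ord_max) *+ s)%MM -> L m)) ->
  almost_revlex (ideal_gen (monomials (K := K) L)).
Proof.
move=> upL borel slp; exists (minimal_elements L); first exact: minimal_generators.
move=> u v [Lu minu] dvu vu; apply/ideal_gen_monomial; rewrite upL.
pose o1 : 'I_3 := @Ordinal 3 1 isT.
have mdeg3 (w : 'X_{1..3}) : mdeg w = (w ord0 + w o1 + w ord_max)%N.
  rewrite mdegE !big_ord_recl big_ord0 addn0 addnA.
  by congr (_ + w _ + w _)%N; apply: val_inj.
have ord3 (j : 'I_3) : [\/ j = ord0, j = o1 | j = ord_max].
  by case: j => -[|[|[|//]]] lj; [constructor 1|constructor 2|constructor 3]; apply: val_inj.
have vu_max : (v ord_max <= u ord_max)%N.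
  by apply: revlex_last_leq vu => // j; rewrite -ltnS ltn_ord.
have [eq_max|neq_max] := eqVneq (v ord_max) (u ord_max).
  have [i vi iuv] := revlexP dvu vu.
  have v1u1 : (v o1 <= u o1)%N.
    case: (ord3 i) vi iuv => -> vi iuv; first by rewrite iuv.
      exact: ltnW.
    by rewrite eq_max ltnn in vi.
  clear i vi iuv minu vu vu_max.
  (* k is the number of moves from x_2 to x_1 that lead from u to v. At k = 0 the equality of
     degrees forces the exponents of x_1 to agree. *)
  have [k uk] : exists k, (u o1 = v o1 + k)%N by exists (u o1 - v o1)%N; rewrite subnKC.
  elim: k u Lu dvu eq_max v1u1 uk => [|k IHk] u Lu dvu eq_max v1u1 uk.
    suff -> : v = u by [].
    rewrite addn0 in uk; apply/mnmP => j; case: (ord3 j) => ->; rewrite ?uk //.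
    by apply/eqP; rewrite -(eqn_add2r (u o1)) -(eqn_add2r (u ord_max)) -mdeg3 -dvu mdeg3 eq_max uk.
  have u1 : (0 < u o1)%N by rewrite uk addnS.
  have [du' _ _] := revlex_borel (isT : (ord0 < o1)%N) u1.
  apply: (IHk _ (borel ord0 o1 u isT u1 Lu)).
  - by rewrite du'.
  - by rewrite eq_max mnmDE mnmBE !mnm1E /= subn0 addn0.
  - by rewrite mnmDE mnmBE !mnm1E /= addn0 uk addnS subn1 leq_addr.
  - by rewrite mnmDE mnmBE !mnm1E /= addn0 uk addnS subn1.
have vu_lt : (v ord_max < u ord_max)%N by rewrite ltn_neqAle neq_max.
have Ul : (U_(ord_max) *+ u ord_max <= u)%MM.
  apply/mnm_lepP => j; rewrite mulmnE mnm1E.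
  by case: eqVneq => [<-|_]; rewrite ?mul1n ?mul0n.
pose m := (u - U_(ord_max) *+ u ord_max)%MM.
have uE : (m + U_(ord_max) *+ u ord_max)%MM = u by rewrite submK.
have u0 : (0 < u ord_max)%N by apply: leq_ltn_trans vu_lt.
have [Lw|Lm] := slp (mdeg m) (u ord_max) u0.
  by apply: Lw => //; rewrite dvu -{1}uE mdegDU_muln.
have mu : m = u by apply: minu; [apply: Lm; rewrite ?uE|exact: lem_subr].
have := mdegDU_muln ord_max (u ord_max) m; rewrite uE mu => /eqP.
by rewrite -{1}[mdeg u]addn0 eqn_add2l eq_sym (gtn_eqF u0).
Qed.

(** * The generic initial ideal: Hilbert function, shape and uniqueness *)

Lemma hilbert_function_gin (K : fieldType) (n : nat) (I : set {mpoly K[n]}) :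
  [pchar K] =i pred0 -> graded_ideal I -> artinian I ->
  hilbert_function (gin I) = hilbert_function I.
Proof.
move=> charK0 gI aI; have [g [ug _ <-]] := gin_generic charK0 0 gI aI.
rewrite hilbert_function_initial_ideal; last exact: coord_change_graded.
exact: hilbert_function_coord_change.
Qed.

Lemma almost_revlex_gin (K : fieldType) (I : set {mpoly K[3]}) :
  [pchar K] =i pred0 -> graded_ideal I -> artinian I -> SLP I -> almost_revlex (gin I).
Proof.
move=> charK0 gI aI slpI; have [D DI] := homog_part_exhausted gI aI.
have [g [ug mg <-]] := gin_generic charK0 D gI aI.
have [idgI _] := coord_change_graded ug gI.
apply: almost_revlex_ideal_gen3; first exact: Lead_upset.
  by move=> i j u ij uj; exact: Lead_image_borel DI mg ij uj.
by apply: Lead_image_SL DI mg _ => // j; rewrite -ltnS ltn_ord.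
Qed.

Theorem theorem20 (K : fieldType) (charK0 : [pchar K]%R =i pred0)
    (I : set {mpoly K[3]}) (gradedI : graded_ideal I)
    (artinianI : artinian I) (slpI : SLP I) :
  [/\ almost_revlex (gin I),
      hilbert_function (gin I) = hilbert_function I,
      (forall J : set {mpoly K[3]}, almost_revlex J ->
         hilbert_function J = hilbert_function I -> J = gin I)
    & (forall I' : set {mpoly K[3]},
         graded_ideal I' -> artinian I' -> SLP I' ->
         hilbert_function I' = hilbert_function I -> gin I' = gin I)].
Proof.
have ginI := almost_revlex_gin charK0 gradedI artinianI slpI.
have HginI := hilbert_function_gin charK0 gradedI artinianI.
split=> // [J rJ HJ|I' gI' aI' slpI' HI'].
  by apply: almost_revlex_unique; rewrite ?HginI.
apply: almost_revlex_unique ginI _; first exact: almost_revlex_gin.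
by rewrite HginI hilbert_function_gin.
Qed.
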